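(* Let $M=(a,b)\times N$ carry the metrics $g=dr^2+G(r)$ and $g_0=dr^2+\mathring{h}^2(r)\hat G$ described in the context, and let $\mathcal M(r)$ be the relative radial mass of $g$ with respect to $g_0$. Suppose that the limits $\mathcal M(a):=\lim_{r\to a}\mathcal M(r)$ and $\mathcal M(b):=\lim_{r\to b}\mathcal M(r)$ exist (as real numbers) and that $\mathring{h}^{2}(R_{rr}-\mathring{R}_{rr})\in L^1(M,dr\,d\mu_{\hat G})$. Then $$\mathcal M(b)-\mathcal M(a)\ \geq\ \int_M\mathring{h}^{2}(R_{rr}-\mathring{R}_{rr})\,dr\,d\mu_{\hat{G}},$$ with equality if and only if $g$ is a warped product in the sense that $G(r)=\mathring{h}^2(r)\widetilde{G}$ for all $r\in(a,b)$, for some fixed (independent of $r$) Riemannian metric $\widetilde{G}$ on $N$. If furthermore $g$ is asymptotic to $g_0$ at some $r_0\in[a,b]$, then equality holds if and only if $g=g_0$.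
   Context: Let $n\geq 2$, let $N$ be a compact $(n-1)$-dimensional smooth manifold (with or without boundary), let $(a,b)$ be an open interval of $\mathbb R$ (possibly unbounded), and $M=(a,b)\times N$, with $r$ the coordinate on $(a,b)$. All objects are assumed $C^\infty$. Let $g=dr^2+G(r)$ be a Riemannian metric on $M$, where $G(r)$ is a family of Riemannian metrics on $N$. Let $g_0=dr^2+\mathring{G}(r)$ with $\mathring{G}(r)=\mathring{h}^2(r)\hat{G}$, where $\mathring{h}$ is a positive function on $(a,b)$ and $\hat{G}$ is a fixed Riemannian metric on $N$, with Riemannian measure $\mu_{\hat G}$. Let $N(r)=\{r\}\times N$, and let $H$ and $\mathring H$ be the mean curvatures (traces of the Weingarten maps with respect to $\partial_r$) of $N(r)$ relative to $g$ and $g_0$: $H=\frac12\operatorname{Tr}(G^{-1}\partial_rG)$ and $\mathring H=(n-1)\mathring h'/\mathring h$. The radial mass at $(r,x)\in M$ is $m(r,x)=\mathring{h}^{2}(\mathring{H}-H)$, and the relative radial mass on $N(r)$ is $\mathcal M(r)=\int_N m(r,x)\,d\mu_{\hat G}(x)$. $R_{rr}$ and $\mathring R_{rr}=-(n-1)\mathring h''/\mathring h$ denote the Ricci curvatures in the $(\partial_r,\partial_r)$ direction of $g$ and $g_0$ respectively. $g$ is said to be asymptotic to $g_0$ at $r_0\in[a,b]$ if $\|G-\mathring G\|_{\mathring G}=o(1)$ as $r\to r_0$, uniformly on $N$ (pointwise norm of tensors on $N$ with respect to $\mathring G(r)$); for $r_0\in(a,b)$ this means that the two metrics coincide on $N(r_0)$.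 *)

(* Defs.v *)
From HB Require Import structures.
From mathcomp Require Import all_boot all_order all_algebra.
From mathcomp Require Import all_classical all_reals all_analysis.

Set Implicit Arguments.
Unset Strict Implicit.
Unset Printing Implicit Defensive.

Import Order.TTheory GRing.Theory Num.Theory.
Import numFieldNormedType.Exports.

Local Open Scope classical_set_scope.
Local Open Scope ring_scope.

Section Calculus.
Context {R : realType} {m : nat}.
Implicit Types (f F : 'rV[R]_m -> R) (c : 'I_m) (y : 'rV[R]_m).

Definition basis_vec c : 'rV[R]_m := delta_mx 0 c.

Definition iter_partial (s : seq 'I_m) f : 'rV[R]_m -> R :=
  foldr (fun c F => 'D_(basis_vec c) F) f s.

Definition smooth_on (U : set 'rV[R]_m) f : Prop :=
  forall s y, U y -> {for y, continuous (iter_partial s f)} /\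
    forall c, derivable (iter_partial s f) y (basis_vec c).

(* Smoothness on an arbitrary subset: f extends locally to a smooth function
   defined on an open set. *)
Definition smooth_within (A : set 'rV[R]_m) f : Prop :=
  forall y, A y -> exists U F, [/\ open U, U y, smooth_on U F &
    forall z, U z -> A z -> f z = F z].

(* Only increments staying in A are used, so that this is a one-sided
   derivative where needed on the boundary of a half-space; it agrees with 'D
   at interior points of A. *)
Definition partial_within (A : set 'rV[R]_m) c f y : R :=
  lim ((fun t : R => t^-1 * (f (t *: basis_vec c + y) - f y))
       @ within [set t | A (t *: basis_vec c + y)] 0^').

(* The last coordinate is nonnegative. *)
Definition half_space : set 'rV[R]_m :=
  [set y | forall c, c = m.-1 :> nat -> 0 <= y 0 c].

End Calculus.

(* A smooth atlas with values in the closed half-space, i.e. the structure of a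
   d-manifold with possibly empty boundary.  The maps are relevant only on the
   chart domains, resp. their images; chart_at selects a chart at each point,
   so as to evaluate chart-independent quantities. *)
Record smooth_atlas (R : realType) (d : nat) (N : topologicalType) := SmoothAtlas {
  chart : Type ;
  chart_dom : chart -> set N ;
  phi : chart -> N -> 'rV[R]_d ;
  psi : chart -> 'rV[R]_d -> N ;
  chart_at : N -> chart ;
  dom_open : forall i, open (chart_dom i) ;
  dom_chart_at : forall p, chart_dom (chart_at p) p ;
  phiK : forall i p, chart_dom i p -> psi i (phi i p) = p ;
  image_open : forall i,
    exists2 U, open U & phi i @` chart_dom i = U `&` half_space ;
  phi_continuous : forall i, {within chart_dom i, continuous (phi i)} ;
  psi_continuous : forall i, {within phi i @` chart_dom i, continuous (psi i)} ;
  transition_smooth : forall i j c,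
    smooth_within (phi i @` (chart_dom i `&` chart_dom j))
      (fun y => phi j (psi i y) 0 c)
}.

Section Metrics.
Context {R : realType} {d : nat} {N : topologicalType}.
Variable A : smooth_atlas R d N.

(* A 2-tensor field given by its components: T i p is its matrix at p in the
   chart i, relevant only if p lies in chart_dom i. *)
Definition tensor_field := chart A -> N -> 'M[R]_d.

Definition same_tensor (S T : tensor_field) : Prop :=
  forall i p, chart_dom i p -> S i p = T i p.

Definition transition_jacobian (i j : chart A) (p : N) : 'M[R]_d :=
  \matrix_(c, e) partial_within (phi i @` (chart_dom i `&` chart_dom j)) e
                   (fun y => phi j (psi i y) 0 c) (phi i p).

Record riemannian_metric (T : tensor_field) : Prop := RiemannianMetric {
  metric_sym : forall i p, chart_dom i p -> (T i p)^T = T i p ;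
  metric_pos : forall i p (v : 'rV[R]_d), chart_dom i p -> v != 0 ->
    0 < (v *m T i p *m v^T) 0 0 ;
  metric_smooth : forall i c e,
    smooth_within (phi i @` chart_dom i) (fun y => T i (psi i y) c e) ;
  metric_transform : forall i j p, chart_dom i p -> chart_dom j p ->
    T i p = (transition_jacobian i j p)^T *m T j p *m transition_jacobian i j p
}.

Definition tensor_norm (P T : 'M[R]_d) : R :=
  Num.sqrt (\tr (invmx P *m T *m invmx P *m T^T)).

End Metrics.

Section RiemannianMeasure.
Context {R : realType}.

(* Iterated Lebesgue integral; for nonnegative Borel f this is the integral
   with respect to d-dimensional Lebesgue measure (Tonelli). *)
Fixpoint lebesgue_iint (d : nat) : ('rV[R]_d -> \bar R) -> \bar R :=
  match d with
  | 0%N => fun f => f 0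
  | d'.+1 => fun f => (\int[lebesgue_measure]_x
      lebesgue_iint (fun y : 'rV[R]_d' => f (row_mx (x%:M : 'rV[R]_1) y)))%E
  end.

Definition borel_type (N : ptopologicalType) := g_sigma_algebraType (@open N).

(* This determines mu, since countably many chart domains cover N. *)
Definition riemannian_measure (d : nat) (N : ptopologicalType)
    (A : smooth_atlas R d N) (T : tensor_field A)
    (mu : set (borel_type N) -> \bar R) : Prop :=
  forall (i : chart A) (B : set (borel_type N)),
    measurable B -> B `<=` chart_dom i ->
    mu B = lebesgue_iint (fun y =>
      (\1_(phi i @` B) y * Num.sqrt (\det (T i (psi i y))))%:E).

End RiemannianMeasure.

Section Ricci.
Context {R : realType} {m : nat}.
Variables (D : set 'rV[R]_m) (g : 'rV[R]_m -> 'M[R]_m).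

(* Gamma^k_ij *)
Definition christoffel (k i j : 'I_m) (y : 'rV[R]_m) : R :=
  2^-1 * \sum_l invmx (g y) k l *
    (partial_within D i (fun z => g z j l) y
     + partial_within D j (fun z => g z i l) y
     - partial_within D l (fun z => g z i j) y).

(* Sign convention: the round sphere has positive Ricci curvature. *)
Definition ricci (j k : 'I_m) (y : 'rV[R]_m) : R :=
  \sum_l (partial_within D l (christoffel l j k) y
          - partial_within D k (christoffel l j l) y)
  + \sum_l \sum_q (christoffel l l q y * christoffel q j k y
                   - christoffel l k q y * christoffel q j l y).

End Ricci.

Section Cylinder.
Context {R : realType} {d : nat} {N : topologicalType}.
Variables (A : smooth_atlas R d N) (a b : \bar R).
Implicit Types (G : R -> tensor_field A) (h : R -> R).

Definition radii : set R := [set r | (a < r%:E < b)%E].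

(* r --> r0 within the interval, for r0 in the extended reals *)
Definition nbhs_in (r0 : \bar R) : set_system R :=
  [set B | \forall e \near r0, forall r, e = r%:E -> radii r -> B r].

(* Coordinates on the cylinder: the 0-th one is r, the others come from a chart
   of N. *)
Definition radial : 'I_(1 + d) := lshift d 0.

Definition cyl_dom (i : chart A) : set 'rV[R]_(1 + d) :=
  [set y : 'rV[R]_(1 + d) |
     radii (y 0 radial) /\ (phi i @` chart_dom i) (rsubmx y)].

Definition cyl_point (i : chart A) (r : R) (p : N) : 'rV[R]_(1 + d) :=
  row_mx (r%:M : 'rV[R]_1) (phi i p).

(* dr^2 + G(r) *)
Definition cyl_metric G (i : chart A) (y : 'rV[R]_(1 + d)) : 'M[R]_(1 + d) :=
  block_mx (1%:M : 'M[R]_1) 0 0 (G (y 0 radial) i (psi i (rsubmx y))).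

Definition cyl_riemannian G : Prop :=
  (forall r, radii r -> riemannian_metric (G r)) /\
  forall i c e, smooth_within (cyl_dom i) (fun y => cyl_metric G i y c e).

Definition same_family G1 G2 : Prop :=
  forall r, radii r -> same_tensor (G1 r) (G2 r).

Definition warped h (T : tensor_field A) : R -> tensor_field A :=
  fun r i p => h r ^+ 2 *: T i p.

Definition mean_curvature G (r : R) (p : N) : R :=
  let i := chart_at A p in
  2^-1 * \tr (invmx (G r i p) *m \matrix_(c, e) derive1 (fun s => G s i p c e) r).

Definition ricci_rr G (r : R) (p : N) : R :=
  let i := chart_at A p in
  ricci (cyl_dom i) (cyl_metric G i) radial radial (cyl_point i r p).

Definition radial_mass h (T : tensor_field A) G (r : R) (p : N) : R :=
  h r ^+ 2 * (mean_curvature (warped h T) r p - mean_curvature G r p).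

Definition asymptotic_at G G0 (r0 : \bar R) : Prop :=
  forall eps : R, 0 < eps -> \forall r \near nbhs_in r0, forall p,
    let i := chart_at A p in
    tensor_norm (G0 r i p) (G r i p - G0 r i p) < eps.

End Cylinder.

Definition relative_mass (R : realType) (d : nat) (N : ptopologicalType)
    (A : smooth_atlas R d N) (mu : {measure set (borel_type N) -> \bar R})
    (h : R -> R) (T : tensor_field A) (G : R -> tensor_field A) (r : R) : R :=
  \int[mu]_(p in setT) radial_mass h T G r p.

Definition ricci_excess (R : realType) (d : nat) (N : topologicalType)
    (A : smooth_atlas R d N) (a b : \bar R) (h : R -> R) (T : tensor_field A)
    (G : R -> tensor_field A) (r : R) (p : N) : R :=
  h r ^+ 2 * (ricci_rr a b G r p - ricci_rr a b (warped h T) r p).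

(* Main.v *)
Require Import Defs.
From HB Require Import structures.
From mathcomp Require Import all_boot all_order all_algebra.
From mathcomp Require Import all_classical all_reals all_analysis.
From mathcomp Require Import measurable_realfun ring lra.

Set Implicit Arguments.
Unset Strict Implicit.
Unset Printing Implicit Defensive.

Import Order.TTheory GRing.Theory Num.Theory.
Import numFieldNormedType.Exports.

Local Open Scope classical_set_scope.
Local Open Scope ring_scope.

(** Let W be the Weingarten map, half of G^-1 G', and k the logarithmic
    derivative h'/h, so that H = tr W and the comparison space has W = k and
    mean curvature (n - 1) k.  The traced Riccati equation
    (tr W)' = - tr W^2 - R_rr, used for both metrics, turns the derivative of
    the radial mass m = h^2 ((n - 1) k - tr W) into a completed square:

      m' = h^2 tr ((W - k)^2) + h^2 (R_rr - R0_rr).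

    The first term, the mass defect, is nonnegative because W - k is
    self-adjoint for G, and it vanishes exactly where G' = 2 k G, that is where
    G / h^2 is radially constant.  Integrating over [al, be] x N and letting
    al and be tend to a and b gives the inequality, the deficit being the
    integral of the mass defect.  In the equality case the defect integrates to
    0; being continuous, and since the measure of a nonempty open set is
    positive, it vanishes identically, so G is h^2 times a fixed metric.  The
    distance of such a G to h^2 Ghat, measured by h^2 Ghat, does not depend on
    r, so it is 0 as soon as it tends to 0 somewhere.

    The parts of this argument are carried as follows.  [posdef_tr_sqr] gives
    the sign of the defect and the case of equality.  [ricci_radial] is the
    traced Riccati equation; it is a computation with Christoffel symbols in
    which all tangential derivatives are those of constants.
    [radial_mass_derive] is the formula for m'.  The mean curvature and the
    defect do not depend on the chart ([curvature_trace_chart]), hence are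
    jointly continuous on the cylinder, and measurable since N is second
    countable ([cvg_measurable_fun]).  The measure is known only through
    iterated Lebesgue integrals in charts, which are estimated on cubes to show
    that it is finite on N and positive on nonempty open sets
    ([riemannian_measure_finite], [riemannian_measure_open_gt0]).
    [mass_balance] is the integrated formula on [al, be] x N, and
    [mass_equality] the equality case. *)

(** * Positive definite matrices *)

Section PositiveDefinite.
Context {R : realType}.

Definition posdef d (P : 'M[R]_d) : Prop :=
  P^T = P /\ forall v : 'rV[R]_d, v != 0 -> 0 < (v *m P *m v^T) 0 0.

(** Gaussian elimination of the first row and column: the Schur complement K - w^T w / a
    is again positive definite, and the induction runs on it. *)
Lemma posdef_congr d (P : 'M[R]_d) : posdef P ->
  exists L : 'M[R]_d, L *m P *m L^T = 1%:M.
Proof.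
elim: d P => [|d IHd] P [symP posP].
  by exists 0; apply/matrixP => -[].
pose a : R := P 0 0.
pose Q : 'M[R]_(1 + d) := P.
pose w := ursubmx Q; pose K := drsubmx Q.
have symQ : Q^T = Q by [].
have posQ (v : 'rV[R]_(1 + d)) : v != 0 -> 0 < (v *m Q *m v^T) 0 0 by apply: posP.
have wT : dlsubmx Q = w^T by rewrite /w trmx_ursub symQ.
have KT : K^T = K by rewrite /K trmx_drsub symQ.
have aE : ulsubmx Q = a%:M.
  by rewrite [ulsubmx Q]mx11_scalar; congr (_ %:M); rewrite !mxE; congr (P _ _); apply/val_inj.
have QE : Q = block_mx a%:M w w^T K by rewrite -aE -wT submxK.
have a_gt0 : 0 < a.
  have /posQ : (row_mx (1%:M : 'M[R]_1) (0 : 'rV_d)) != 0.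
    apply/eqP => /(congr1 (fun M : 'rV[R]_(1 + d) => M 0 (lshift d 0))).
    by rewrite row_mxEl !mxE eqxx => /eqP; rewrite oner_eq0.
  rewrite QE mul_row_block tr_row_mx mul_row_col.
  by rewrite !mul1mx !mul0mx !addr0 trmx0 mulmx0 addr0 trmx1 mulmx1 mxE eqxx.
have a_neq0 : a != 0 by rewrite gt_eqF.
pose S : 'M[R]_d := K - a^-1 *: (w^T *m w).
have [L LS] : exists L : 'M[R]_d, L *m S *m L^T = 1%:M.
  apply: IHd; split.
    by rewrite /S linearB /= KT linearZ /= trmx_mul trmxK.
  move=> v v0.
  pose z : 'rV[R]_(1 + d) := row_mx (- a^-1 *: (v *m w^T)) v.
  have z0 : z != 0.
    apply: contraNneq v0 => z0; apply/eqP.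
    by rewrite -[v](row_mxKr (- a^-1 *: (v *m w^T))) -/z z0 linear0.
  have := posQ z z0; rewrite QE /z mul_row_block tr_row_mx mul_row_col.
  rewrite mul_mx_scalar scalerA mulrN divff// scaleN1r.
  rewrite addNr mul0mx add0r.
  rewrite /S mulmxBr -scalemxAr -scalemxAl mulmxA.
  by rewrite -scaleNr addrC.
have sa : Num.sqrt a != 0 by rewrite sqrtr_eq0 -ltNge.
suff [T TQ] : exists T : 'M[R]_(1 + d), T *m Q *m T^T = 1%:M by exists T.
(* scales the first row to norm 1 and clears w^T from the rows below *)
exists (block_mx (Num.sqrt a)^-1%:M 0 (- a^-1 *: (L *m w^T)) L).
rewrite QE tr_block_mx trmx0 !mulmx_block.
rewrite !mul0mx !mulmx0 !addr0 !mul_mx_scalar !scalerA !mulrN divff// !scaleN1r.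
rewrite addNr !mul0mx !add0r.
rewrite linearZ /= trmx_mul trmxK tr_scalar_mx.
rewrite !mul_scalar_mx !mul_mx_scalar.
rewrite [X in block_mx _ X _ _](_ : _ = 0); last first.
  rewrite scale_scalar_mx mul_scalar_mx scalerA mulrN mulrAC divff// mul1r.
  by rewrite -scalemxAl scaleNr addNr.
rewrite [X in block_mx X _ _ _](_ : _ = 1%:M); last first.
  rewrite !scale_scalar_mx; congr (_ %:M).
  by rewrite -{2}[a]sqr_sqrtr ?ltW// expr2; field.
rewrite [X in block_mx _ _ _ X](_ : _ = 1%:M); last first.
  rewrite -LS /S mulmxBr addrC; congr (_ *m _); congr (_ + _).
  by rewrite -scalemxAr -scalemxAl scaleNr !mulmxA.
by rewrite -scalar_mx_block.
Qed.

Lemma posdef_unit d (P : 'M[R]_d) : posdef P -> P \in unitmx.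
Proof.
by case/posdef_congr => L /mulmx1_unit [] + _; rewrite unitmx_mul => /andP[].
Qed.

Lemma tr_sqr_sym d (B : 'M[R]_d) : B^T = B ->
  \tr (B *m B) = \sum_i \sum_j B i j ^+ 2.
Proof.
move=> symB; apply: eq_bigr => i _; rewrite mxE; apply: eq_bigr => j _.
by rewrite -{2}symB mxE expr2.
Qed.

(** With L P L^T = 1 one has P^-1 = L^T L, so the trace is that of the square
    of the symmetric matrix L S L^T, a sum of squares of entries.  This is the
    spectral fact that P^-1 S is self-adjoint for P. *)
Lemma posdef_tr_sqr d (P S : 'M[R]_d) : posdef P -> S^T = S ->
  0 <= \tr (invmx P *m S *m (invmx P *m S)) /\
  (\tr (invmx P *m S *m (invmx P *m S)) = 0 -> S = 0).
Proof.
move=> Ppos symS; have [L LP] := posdef_congr Ppos.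
have [Lu LTu] : L \in unitmx /\ L^T \in unitmx.
  have [+ ->] := mulmx1_unit LP; rewrite unitmx_mul => /andP[-> _] //.
have Pinv : invmx P = L^T *m L.
  have Pu := posdef_unit Ppos.
  rewrite -[RHS]mulmx1 -(mulmxV Pu) !mulmxA -[_ *m L *m P]mulmxA.
  have -> : L *m P = invmx L^T by rewrite -[LHS](mulmxK LTu) LP mul1mx.
  by rewrite mulmxV// mul1mx.
pose B := L *m S *m L^T.
have symB : B^T = B by rewrite /B !trmx_mul trmxK symS mulmxA.
have -> : \tr (invmx P *m S *m (invmx P *m S)) = \tr (B *m B).
  by rewrite Pinv -!mulmxA mxtrace_mulC /B -!mulmxA.
rewrite tr_sqr_sym//; split.
  by apply: sumr_ge0 => i _; apply: sumr_ge0 => j _; apply: sqr_ge0.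
move=> sum0; suff B0 : B = 0.
  by rewrite -[S](mulKmx Lu) -[L *m S](mulmxK LTu) -/B B0 mul0mx mulmx0.
apply/matrixP => i j; rewrite [RHS]mxE.
have /psumr_eq0P := sum0 => /(_ (fun i _ => sumr_ge0 _ (fun j _ => sqr_ge0 _))).
move=> /(_ i isT) /psumr_eq0P => /(_ (fun j _ => sqr_ge0 _)) /(_ j isT) /eqP.
by rewrite sqrf_eq0 => /eqP.
Qed.

Lemma tr_conj d (J X : 'M[R]_d) : J \in unitmx -> \tr (invmx J *m X *m J) = \tr X.
Proof. by move=> Ju; rewrite mxtrace_mulC mulmxA mulmxV// mul1mx. Qed.

(** How a (1,1)-tensor P^-1 D transforms when the bilinear forms P and D are
    pulled back by J; invertibility of J comes for free from that of J^T P J. *)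
Lemma congr_invmx_mul d (J P D : 'M[R]_d) : J^T *m P *m J \in unitmx ->
  J \in unitmx /\
  invmx (J^T *m P *m J) *m (J^T *m D *m J) = invmx J *m (invmx P *m D) *m J.
Proof.
move=> u; have := u; rewrite !unitmx_mul => /andP[/andP[JTu Pu] Ju]; split => //.
apply: (can_inj (mulKmx u)); rewrite mulKVmx// !mulmxA.
by rewrite -!mulmxA (mulmxA J) mulmxV// mul1mx (mulmxA P) mulmxV// mul1mx.
Qed.

End PositiveDefinite.

(** * Limits and derivatives of matrix-valued functions *)

Section MatrixLimits.
Context {R : realType}.

Lemma cvg_mxP T (F : set_system T) {FF : Filter F} m n (A : T -> 'M[R]_(m, n))
    (L : 'M[R]_(m, n)) :
  A x @[x --> F] --> L <-> forall i j, A x i j @[x --> F] --> L i j.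
Proof.
split=> [AL i j|AL].
  exact: (cvg_comp _ _ AL (@coord_continuous R m n i j L)).
move=> B [P LP PB]; rewrite /nbhs /=.
apply: filterS (_ : F (fun x => forall i j, P i j (A x i j))).
  by move=> x Px; apply: PB.
apply: filter_forall => i; apply: filter_forall => j.
exact: AL (LP i j).
Qed.

Lemma cvg_sum T (F : set_system T) {FF : Filter F} I (s : seq I) (P : pred I)
    (f : I -> T -> R) (l : I -> R) : (forall i, P i -> f i x @[x --> F] --> l i) ->
  \sum_(i <- s | P i) f i x @[x --> F] --> \sum_(i <- s | P i) l i.
Proof. by move=> fl; apply: cvg_big => // -[x y]; apply: add_continuous. Qed.

Lemma cvg_prod T (F : set_system T) {FF : Filter F} I (s : seq I) (P : pred I)
    (f : I -> T -> R) (l : I -> R) : (forall i, P i -> f i x @[x --> F] --> l i) ->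
  \prod_(i <- s | P i) f i x @[x --> F] --> \prod_(i <- s | P i) l i.
Proof. by move=> fl; apply: cvg_big => // -[x y]; apply: mul_continuous. Qed.

Section Filter.
Context {T : Type} {F : set_system T} {FF : Filter F}.

Lemma cvg_mulmx m n p (A : T -> 'M[R]_(m, n)) (B : T -> 'M[R]_(n, p))
    (A0 : 'M[R]_(m, n)) (B0 : 'M[R]_(n, p)) :
  A x @[x --> F] --> A0 -> B x @[x --> F] --> B0 ->
  A x *m B x @[x --> F] --> A0 *m B0.
Proof.
move=> /cvg_mxP cA /cvg_mxP cB; apply/cvg_mxP => i j; rewrite mxE.
under eq_cvg do rewrite mxE.
by apply: cvg_sum => k _; apply: cvgM; [apply: cA|apply: cB].
Qed.

Lemma cvg_mxtrace n (A : T -> 'M[R]_n) (A0 : 'M[R]_n) :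
  A x @[x --> F] --> A0 -> \tr (A x) @[x --> F] --> \tr A0.
Proof. by move=> /cvg_mxP cA; apply: cvg_sum => i _; apply: cA. Qed.

Lemma cvg_det n (A : T -> 'M[R]_n) (A0 : 'M[R]_n) :
  A x @[x --> F] --> A0 -> \det (A x) @[x --> F] --> \det A0.
Proof.
move=> /cvg_mxP cA; apply: cvg_sum => s _; apply: cvgM; first exact: cvg_cst.
by apply: cvg_prod => i _; apply: cA.
Qed.

Lemma cvg_invmx n (A : T -> 'M[R]_n) (A0 : 'M[R]_n) : A0 \in unitmx ->
  (\forall x \near F, A x \in unitmx) ->
  A x @[x --> F] --> A0 -> invmx (A x) @[x --> F] --> invmx A0.
Proof.
move=> A0u Au cA; rewrite [in X in _ --> X]/invmx A0u.
apply: (@cvg_trans _ ((fun x => (\det (A x))^-1 *: \adj (A x)) @ F)).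
  apply: near_eq_cvg; apply: filterS Au => x Axu.
  by rewrite /invmx Axu.
apply: cvgZ.
  apply: cvgV; last exact: cvg_det.
  by rewrite -unitfE -unitmxE.
apply/cvg_mxP => i j; rewrite mxE; under eq_cvg do rewrite mxE.
apply: cvgM; first exact: cvg_cst.
apply: cvg_det; apply/cvg_mxP => k l; rewrite !mxE.
under eq_cvg do rewrite !mxE.
by move/cvg_mxP : cA; apply.
Qed.

End Filter.

Lemma is_deriveP (V : normedModType R) (f : R -> V) (r : R) (df : V) :
  is_derive r 1 f df <->
  (h^-1 *: (f (h + r) - f r)) @[h --> 0^'] --> df.
Proof.
have E : (fun h => h^-1 *: ((f \o shift r) (h *: (1 : R^o)) - f r)) =
         (fun h => h^-1 *: (f (h + r) - f r)).
  by apply/funext => h /=; rewrite /GRing.scale /= mulr1.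
split=> [[fr <-]|].
  by move: fr; rewrite /derivable /derive E.
move=> fr; split; first by rewrite /derivable E; apply/cvg_ex; exists df.
by rewrite /derive E; apply/cvg_lim.
Qed.

Lemma is_derive_cvg_shift (V : normedModType R) (f : R -> V) (r : R) (df : V) :
  is_derive r 1 f df -> f (h + r) @[h --> 0^'] --> f r.
Proof.
move=> [/derivable1_diffP/differentiable_continuous fr _].
have : (h + r) @[h --> 0^'] --> r.
  rewrite -{2}[r]add0r; apply: cvgD; last exact: cvg_cst.
  exact: nbhs_dnbhs.
by move/(cvg_comp _ _); apply.
Qed.

Lemma is_derive_mulmx m n p (A : R -> 'M[R]_(m, n)) (B : R -> 'M[R]_(n, p)) (r : R)
    (dA : 'M[R]_(m, n)) (dB : 'M[R]_(n, p)) :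
  is_derive r 1 A dA -> is_derive r 1 B dB ->
  is_derive r 1 (fun s => A s *m B s) (dA *m B r + A r *m dB).
Proof.
move=> dAr dBr; apply/is_deriveP.
have cB := is_derive_cvg_shift dBr.
rewrite (_ : (fun h => _) = (fun h : R => (h^-1 *: (A (h + r) - A r)) *m B (h + r)
   + A r *m (h^-1 *: (B (h + r) - B r)))); last first.
  apply/funext => h; rewrite -scalemxAl -scalemxAr -scalerDr; congr (_ *: _).
  by rewrite mulmxBl mulmxBr addrA subrK.
apply: cvgD; apply: cvg_mulmx => //.
- exact/is_deriveP.
- exact: cvg_cst.
- exact/is_deriveP.
Qed.

(** From A(s)^-1 - A(r)^-1 = - A(s)^-1 (A(s) - A(r)) A(r)^-1: continuity of the
    inverse already gives its derivative. *)
Lemma is_derive_invmx n (A : R -> 'M[R]_n) (r : R) (dA : 'M[R]_n) :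
  (\forall s \near r, A s \in unitmx) -> is_derive r 1 A dA ->
  is_derive r 1 (fun s => invmx (A s)) (- (invmx (A r) *m dA *m invmx (A r))).
Proof.
move=> Au dAr; apply/is_deriveP.
have Aru := nbhs_singleton Au.
have cr : (h + r) @[h --> 0^'] --> r.
  rewrite -{2}[r]add0r; apply: cvgD; last exact: cvg_cst.
  exact: nbhs_dnbhs.
have Au' : \forall h \near 0^', A (h + r) \in unitmx by apply: cr Au.
apply: (@cvg_trans _ ((fun h : R =>
   - (invmx (A (h + r)) *m (h^-1 *: (A (h + r) - A r)) *m invmx (A r))) @ 0^')).
  apply: near_eq_cvg; apply: filterS Au' => h Ahu.
  rewrite -scalemxAr -scalemxAl -scalerN; congr (_ *: _).
  rewrite mulmxBr mulmxBl mulVmx// mul1mx opprB; congr (_ - _).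
  by rewrite -mulmxA mulmxV// mulmx1.
apply: cvgN; apply: cvg_mulmx; last exact: cvg_cst.
apply: cvg_mulmx; last exact/is_deriveP.
by apply: cvg_invmx => //; apply: is_derive_cvg_shift dAr.
Qed.

Lemma is_derive_mxtrace n (A : R -> 'M[R]_n) (r : R) (dA : 'M[R]_n) :
  is_derive r 1 A dA -> is_derive r 1 (fun s => \tr (A s)) (\tr dA).
Proof.
move=> /is_deriveP dAr; apply/is_deriveP.
rewrite (_ : (fun h => _) = (fun h : R => \tr (h^-1 *: (A (h + r) - A r)))).
  exact: cvg_mxtrace.
by apply/funext => h; rewrite mxtraceZ [in RHS]linearB.
Qed.

Lemma is_derive_mxP m n (A : R -> 'M[R]_(m, n)) (r : R) (dA : 'M[R]_(m, n)) :
  is_derive r 1 A dA <-> forall i j, is_derive r 1 (fun s => A s i j) (dA i j).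
Proof.
split=> [/is_deriveP/cvg_mxP dAr i j|dAr].
  apply/is_deriveP; apply: cvg_trans (dAr i j).
  by apply: near_eq_cvg; apply: nearW => h; rewrite !mxE.
apply/is_deriveP/cvg_mxP => i j; have /is_deriveP := dAr i j.
apply: cvg_trans; apply: near_eq_cvg; apply: nearW => h; by rewrite !mxE.
Qed.

Lemma is_derive_trmx m n (A : R -> 'M[R]_(m, n)) (r : R) (dA : 'M[R]_(m, n)) :
  is_derive r 1 A dA -> is_derive r 1 (fun s => (A s)^T) dA^T.
Proof.
move=> dAr; apply/is_derive_mxP => i j; rewrite mxE.
rewrite (_ : (fun s => _) = (fun s => A s j i)); last by apply/funext => s; rewrite mxE.
by have /is_derive_mxP := dAr; apply.
Qed.

Lemma is_derive_scalemx m n (f : R -> R) (A : 'M[R]_(m, n)) (r df : R) :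
  is_derive r 1 f df -> is_derive r 1 (fun s => f s *: A) (df *: A).
Proof.
move=> dfr; apply/is_derive_mxP => i j; rewrite mxE.
rewrite (_ : (fun s => _) = (fun s => A i j *: f s)).
  by rewrite mulrC; exact: is_deriveZ.
by apply/funext => s; rewrite mxE mulrC.
Qed.

Lemma is_derive_unique (V : normedModType R) (f : R -> V) (r : R) (d1 d2 : V) :
  is_derive r 1 f d1 -> is_derive r 1 f d2 -> d1 = d2.
Proof. by move=> [_ <-] [_ <-]. Qed.

End MatrixLimits.

(** * Radial smoothness of the family of metrics *)

Section RadialInterval.
Context {R : realType} (a b : \bar R).

Lemma radii_open : open (radii a b).
Proof.
have -> : radii a b = [set r | (a < r%:E)%E] `&` [set r | (r%:E < b)%E].
  by apply/seteqP; split => r /=; [move/andP|case=> ? ?; apply/andP].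
by apply: openI; [exact: open_ereal_gt|exact: open_ereal_lt].
Qed.

Lemma radii_near r : radii a b r -> \forall s \near r, radii a b s.
Proof. by move=> ar; apply: open_nbhs_nbhs; split => //; exact: radii_open. Qed.

Lemma radii_between r s t : radii a b r -> radii a b t -> r <= s -> s <= t ->
  radii a b s.
Proof.
move=> /andP[ar _] /andP[_ tb] rs st; apply/andP; split.
  by rewrite (lt_le_trans ar)// lee_fin.
by rewrite (le_lt_trans _ tb)// lee_fin.
Qed.

End RadialInterval.

Section RadialSmoothness.
Context {R : realType} {d : nat} {N : topologicalType}.
Variables (A : smooth_atlas R d N) (a b : \bar R).

Lemma nbhs_chart_dom (i : chart A) p : chart_dom i p -> \forall q \near p, chart_dom i q.
Proof. by move=> ip; apply: open_nbhs_nbhs; split => //; exact: dom_open. Qed.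

Lemma phi_cvg (i : chart A) p : chart_dom i p -> phi i q @[q --> p] --> phi i p.
Proof.
move=> ip; have := @phi_continuous _ _ _ A i.
rewrite continuous_open_subspace; last exact: dom_open.
by apply; rewrite inE.
Qed.

Lemma cyl_point_radial (i : chart A) r p : cyl_point i r p 0 (@radial d) = r.
Proof. by rewrite /cyl_point row_mxEl mxE eqxx. Qed.

Lemma cyl_point_rsubmx (i : chart A) r p : rsubmx (cyl_point i r p) = phi i p.
Proof. exact: row_mxKr. Qed.

Lemma cyl_point_shift (i : chart A) r t p :
  t *: basis_vec (@radial d) + cyl_point i r p = cyl_point i (t + r) p.
Proof.
rewrite /cyl_point /basis_vec /radial; apply/rowP => j.
rewrite [LHS]mxE [X in X + _]mxE [X in _ * X]mxE.
case: (split_ordP j) => k ->.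
  by rewrite !row_mxEl !mxE !ord1 !eqxx mulr1.
rewrite !row_mxEr (_ : rshift 1 k == lshift d 0 = false).
  by rewrite andbF mulr0 add0r.
by apply/eqP => /(congr1 val).
Qed.

Lemma cyl_point_cvg (i : chart A) (z : R * N) : chart_dom i z.2 ->
  cyl_point i w.1 w.2 @[w --> z] --> cyl_point i z.1 z.2.
Proof.
move=> iz; apply/cvg_mxP => k j.
case: (split_ordP j) => l ->.
  under eq_cvg do rewrite row_mxEl mxE.
  rewrite row_mxEl mxE !ord1 eqxx !mulr1n; exact: cvg_fst.
under eq_cvg do rewrite row_mxEr.
rewrite row_mxEr.
have phiz : phi i w.2 @[w --> z] --> phi i z.2.
  by apply: cvg_comp (phi_cvg iz); exact: cvg_snd.
by move/cvg_mxP : phiz; apply.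
Qed.

Lemma cyl_dom_point (i : chart A) r p : radii a b r -> chart_dom i p ->
  cyl_dom a b i (cyl_point i r p).
Proof.
move=> ar ip; split; first by rewrite cyl_point_radial.
by rewrite cyl_point_rsubmx; exists p.
Qed.

Definition radial_jet (G : R -> tensor_field A) (i : chart A) (k : nat) (r : R)
    (p : N) : 'M[R]_d :=
  \matrix_(c, e) derive1n k (fun s => G s i p c e) r.

Lemma radial_jet0 G i r p : radial_jet G i 0 r p = G r i p.
Proof. by apply/matrixP => c e; rewrite mxE. Qed.

Variables (G : R -> tensor_field A) (G_riem : cyl_riemannian a b G).

(** A local smooth extension F of the metric coefficients agrees with them along
    the radial lines, which stay in the cylinder even over the boundary of N.
    So the k-th radial derivative of G is the k-th partial derivative of F, at
    all points near the given one, and inherits its joint continuity. *)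
Lemma radial_smooth (i : chart A) c e k r p : radii a b r -> chart_dom i p ->
  is_derive r 1 (derive1n k (fun s => G s i p c e))
    (derive1n k.+1 (fun s => G s i p c e) r) /\
  derive1n k (fun s => G s i z.2 c e) z.1 @[z --> (r, p)] -->
    derive1n k (fun s => G s i p c e) r.
Proof.
move=> ar ip.
have [U [F [Uo Uy Fs FE]]] :=
  G_riem.2 i (rshift 1 c) (rshift 1 e) _ (cyl_dom_point ar ip).
pose X (z : R * N) := cyl_point i z.1 z.2.
pose W (z : R * N) := [/\ radii a b z.1, chart_dom i z.2 & U (X z)].
have nearW z : W z -> \forall w \near z, W w.
  move=> [zr zi zU].
  have n1 : \forall w \near z, radii a b w.1 by apply: cvg_fst (radii_near zr).
  have n2 : \forall w \near z, chart_dom i w.2 by apply: cvg_snd (nbhs_chart_dom zi).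
  have n3 : \forall w \near z, U (X w).
    by apply: (cyl_point_cvg zi); apply: open_nbhs_nbhs.
  by near do split.
have nearW1 s q : W (s, q) -> \forall t \near s, W (t, q).
  move=> /nearW Wn; apply: (_ : (fun t => (t, q)) @ s --> (s, q)) Wn.
  by apply: (@cvg_pair _ _ _ _ (nbhs s) (nbhs q)); [exact: cvg_id|exact: cvg_cst].
pose Phi k := iter_partial (nseq k (@radial d)) F.
have GF z : W z -> G z.1 i z.2 c e = F (X z).
  move=> [zr zi zU]; rewrite -FE//; last exact: cyl_dom_point.
  by rewrite /cyl_metric block_mxEdr /X cyl_point_radial cyl_point_rsubmx phiK.
have PhiD l z : W z -> is_derive z.1 1 (fun s => Phi l (X (s, z.2))) (Phi l.+1 (X z)).
  move=> [_ _ /Fs - /(_ (nseq l (@radial d))) [_ /(_ (@radial d))]].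
  rewrite -/(Phi l) => Dl.
  rewrite /Phi /= -/(Phi l).
  have E : (fun h => h^-1 *:
      ((Phi l \o shift (X z)) (h *: basis_vec (@radial d)) - Phi l (X z)))
         = (fun h => h^-1 *: (Phi l (X (h + z.1, z.2)) - Phi l (X (z.1, z.2)))).
    by apply/funext => h /=; rewrite cyl_point_shift.
  apply/is_deriveP; move: Dl; rewrite /derive /derivable E.
  by [].
have main l z : W z -> derive1n l (fun s => G s i z.2 c e) z.1 = Phi l (X z).
  elim: l z => [|l IHl] z Wz; first exact: GF.
  rewrite derive1nS derive1E.
  have [_ <-] := PhiD l z Wz.
  apply: near_eq_derive; apply: filterS (nearW1 _ _ Wz) => s Wsz.
  exact: (IHl (s, z.2)).
have Wrp : W (r, p) by split.
split.
  rewrite (main k.+1 (r, p) Wrp).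
  apply: near_eq_is_derive (PhiD k (r, p) Wrp) => //=.
  apply: filterS (nearW1 _ _ Wrp) => s Wsp; rewrite -(main k _ Wsp) //.
rewrite (main k (r, p) Wrp).
apply: (@cvg_trans _ ((fun z => Phi k (X z)) @ (r, p))).
  apply: near_eq_cvg; apply: filterS (nearW _ Wrp) => z Wz.
  by rewrite main.
have [+ _] := Fs (nseq k (@radial d)) _ Uy.
move=> /(cvg_comp _ _ (cyl_point_cvg _ : X z @[z --> (r, p)] --> X (r, p))); exact.
Unshelve. all: by end_near. Qed.

Lemma radial_jet_derive (i : chart A) k r p : radii a b r -> chart_dom i p ->
  is_derive r 1 (radial_jet G i k ^~ p) (radial_jet G i k.+1 r p).
Proof.
move=> ar ip; apply/is_derive_mxP => c e; rewrite mxE.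
have [dG _] := radial_smooth c e k ar ip.
suff -> : (fun s => radial_jet G i k s p c e) = derive1n k (fun s => G s i p c e) by [].
by apply/funext => s; rewrite mxE.
Qed.

Lemma radial_jet_cvg (i : chart A) k r p : radii a b r -> chart_dom i p ->
  radial_jet G i k z.1 z.2 @[z --> (r, p)] --> radial_jet G i k r p.
Proof.
move=> ar ip; apply/cvg_mxP => c e; rewrite mxE.
under eq_cvg do rewrite mxE.
by have [_] := radial_smooth c e k ar ip.
Qed.

End RadialSmoothness.

(** * Ricci curvature in the radial direction *)

Section RadialRicci.
Context {R : realType} {d : nat} {N : topologicalType}.
Variables (A : smooth_atlas R d N) (a b : \bar R).

(** Every coordinate direction leaves room in the cylinder, at the boundary at
    least for positive increments; without this the limits that define partial
    derivatives would be meaningless. *)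
Lemma cyl_dom_within_proper (i : chart A) c (y : 'rV[R]_(1 + d)) : cyl_dom a b i y ->
  ProperFilter (within [set t : R | cyl_dom a b i (t *: basis_vec c + y)] 0^').
Proof.
move=> [yr yi]; have [U Uo UE] := image_open i.
have [Uy Hy] : U (rsubmx y) /\ half_space (rsubmx y) by move: yi; rewrite UE.
have shift_cvg : t *: basis_vec c + y @[t --> (0 : R)] --> y.
  rewrite -{2}[y]add0r -(scale0r (basis_vec c)).
  apply: cvgD; last exact: cvg_cst.
  apply: cvgZr_tmp; exact: cvg_id.
apply: Build_ProperFilter_ex => B; rewrite /within /= => nB.
have n1 : \forall t \near (0 : R), radii a b ((t *: basis_vec c + y) 0 (@radial d)).
  move/cvg_mxP : shift_cvg => /(_ 0 (@radial d)); apply; exact: radii_near.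
have n2 : \forall t \near (0 : R), U (rsubmx (t *: basis_vec c + y)).
  have : rsubmx (t *: basis_vec c + y) @[t --> (0 : R)] --> rsubmx y.
    apply/cvg_mxP => k j; rewrite mxE; under eq_cvg do rewrite mxE.
    by move/cvg_mxP : shift_cvg; apply.
  by apply; apply: open_nbhs_nbhs.
have /nbhs_ballP [e /= e0 eB] : \forall t \near (0 : R), t != 0 ->
    [/\ radii a b ((t *: basis_vec c + y) 0 (@radial d)),
        U (rsubmx (t *: basis_vec c + y)) &
        cyl_dom a b i (t *: basis_vec c + y) -> B t].
  move: nB; rewrite near_withinE => nB.
  by near=> t => t0; split; [near: t|near: t|move: t0; near: t].
have e20 : 0 < e / 2 by rewrite divr_gt0.
have [] := eB (e / 2).
- by rewrite /ball /= sub0r normrN gtr0_norm// ltr_pdivrMr// ltr_pMr// ltr1n.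
- by rewrite gt_eqF.
move=> r1 U1 B1; exists (e / 2); apply: B1; split => //.
rewrite UE; split => // k kd; rewrite !mxE.
have := Hy k kd; rewrite mxE => Hk.
by apply: addr_ge0 => //; rewrite mulr_ge0// ltW.
Unshelve. all: by end_near. Qed.

Lemma partial_within_cst (i : chart A) c (f : 'rV[R]_(1 + d) -> R) (k : R) y :
  cyl_dom a b i y -> (forall z, cyl_dom a b i z -> f z = k) ->
  partial_within (cyl_dom a b i) c f y = 0.
Proof.
move=> iy fk; have FF := cyl_dom_within_proper c iy.
apply/cvg_lim => //.
apply: (@cvg_trans _ (cst (0 : R) @
  within [set t : R | cyl_dom a b i (t *: basis_vec c + y)] 0^')).
  apply: near_eq_cvg; rewrite near_withinE; apply: nearW => t it.
  by rewrite !fk// subrr mulr0.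
exact: cvg_cst.
Qed.

Lemma partial_within_radial (i : chart A) (f : 'rV[R]_(1 + d) -> R) r p (df : R) :
  radii a b r -> chart_dom i p ->
  is_derive r 1 (fun s => f (cyl_point i s p)) df ->
  partial_within (cyl_dom a b i) (@radial d) f (cyl_point i r p) = df.
Proof.
move=> ar ip /is_deriveP dfr.
have FF := cyl_dom_within_proper (@radial d) (cyl_dom_point ar ip).
apply/cvg_lim => //.
under eq_cvg do rewrite cyl_point_shift.
exact: cvg_within_filter dfr.
Qed.


Section Christoffel.
Variables (G : R -> tensor_field A) (i : chart A).
Let D := cyl_dom a b i.
Let g := cyl_metric G i.

(** The row and the column of r in dr^2 + G are constant; this is what kills all
    tangential derivatives below. *)
Lemma cyl_metric_radial y (j : 'I_(1 + d)) :
  g y (@radial d) j = (j == @radial d)%:R /\ g y j (@radial d) = (j == @radial d)%:R.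
Proof.
rewrite /g /cyl_metric /radial; case: (split_ordP j) => k ->.
  by rewrite ord1 block_mxEul mxE !eqxx.
rewrite (_ : (rshift 1 k == _) = false); last by apply/eqP => /(congr1 val).
by rewrite block_mxEur block_mxEdl !mxE.
Qed.

Lemma partial_metric_radial c y (j : 'I_(1 + d)) : D y ->
  partial_within D c (fun z => g z (@radial d) j) y = 0 /\
  partial_within D c (fun z => g z j (@radial d)) y = 0.
Proof.
move=> Dy; split; apply: (partial_within_cst _ (k := (j == @radial d)%:R)) => // z _.
  by have [] := cyl_metric_radial z j.
by have [] := cyl_metric_radial z j.
Qed.

Lemma christoffel_rr l y : D y -> christoffel D g l (@radial d) (@radial d) y = 0.
Proof.
move=> Dy; rewrite /christoffel big1 ?mulr0// => m _.
have E c j := partial_metric_radial c j Dy.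
by rewrite !(E _ _).1 subr0 addr0 mulr0.
Qed.

Variable p : N.
Hypothesis ip : chart_dom i p.
Variables P P1 : R -> 'M[R]_d.
Hypothesis GP : forall s, G s i p = P s.
Hypothesis Punit : forall s, radii a b s -> P s \in unitmx.
Hypothesis Psym : forall s, radii a b s -> (P s)^T = P s.
Hypothesis dP : forall s, radii a b s -> is_derive s 1 P (P1 s).

Lemma cyl_metric_point s : g (cyl_point i s p) = block_mx 1%:M 0 0 (P s).
Proof. by rewrite /g /cyl_metric cyl_point_radial cyl_point_rsubmx phiK// GP. Qed.

Lemma invmx_cyl_metric s : radii a b s ->
  invmx (g (cyl_point i s p)) = block_mx 1%:M 0 0 (invmx (P s)).
Proof.
move=> ar; rewrite cyl_metric_point invmx_block_diag ?invmx1//.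
by rewrite unitmxE det_ublock unitrM -!unitmxE unitmx1 Punit.
Qed.

Lemma christoffel_r_r s j : radii a b s ->
  christoffel D g (@radial d) (@radial d) j (cyl_point i s p) = 0.
Proof.
move=> ar; have Dy := cyl_dom_point ar ip.
have E c k := partial_metric_radial c k Dy.
rewrite /christoffel big_split_ord /= big_ord1.
rewrite [X in _ + X]big1 ?addr0.
  by rewrite !(E _ _).2 !(E _ _).1 !addr0 subr0 !mulr0.
by move=> k _; rewrite invmx_cyl_metric// block_mxEur mxE mul0r.
Qed.

(** The Christoffel symbols with one radial lower index, the other indices being
    tangential, are the entries of the Weingarten map. *)
Lemma christoffel_r s (l q : 'I_d) : radii a b s ->
  christoffel D g (rshift 1 l) (@radial d) (rshift 1 q) (cyl_point i s p) =
  2^-1 * (invmx (P s) *m P1 s) l q.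
Proof.
move=> ar; have Dy := cyl_dom_point ar ip.
have E c k := partial_metric_radial c k Dy.
rewrite /christoffel big_split_ord /= big_ord1.
rewrite invmx_cyl_metric// block_mxEdl mxE mul0r add0r mxE; congr (_ * _).
apply: eq_bigr => m _; rewrite block_mxEdr; congr (_ * _).
rewrite !(E _ _).1 addr0 subr0.
transitivity (P1 s q m).
  apply: partial_within_radial => //.
  rewrite (_ : (fun t => _) = (fun t => P t q m)).
    by have /is_derive_mxP := dP ar; apply.
  by apply/funext => t; rewrite cyl_metric_point block_mxEdr.
have P1sym : (P1 s)^T = P1 s.
    apply: (is_derive_unique _ (dP ar)).
    apply: near_eq_is_derive (is_derive_trmx (dP ar)).
    by apply: filterS (radii_near ar) => t at_; exact: Psym.
by rewrite -{1}P1sym mxE.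
Qed.

(** The traced Riccati equation: with W half of P^-1 P', the right-hand side is
    - (tr W)' - tr W^2. *)
Lemma ricci_radial r P2 : radii a b r -> is_derive r 1 P1 P2 ->
  ricci D g (@radial d) (@radial d) (cyl_point i r p) =
  - (2^-1 * \tr (invmx (P r) *m P2))
  + 4^-1 * \tr (invmx (P r) *m P1 r *m (invmx (P r) *m P1 r)).
Proof.
move=> ar dP1; have Dy := cyl_dom_point ar ip.
pose W s := invmx (P s) *m P1 s.
pose dW : 'M[R]_d := invmx (P r) *m P2 - W r *m W r.
have dWr : is_derive r 1 W dW.
  have Pu : \forall s \near r, P s \in unitmx.
    by apply: filterS (radii_near ar) => s; exact: Punit.
  have := is_derive_mulmx (is_derive_invmx Pu (dP ar)) dP1.
  by congr is_derive; rewrite /dW addrC mulNmx /W !mulmxA.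
rewrite /ricci.
(* first-order terms: only the derivatives of the diagonal entries of W remain *)
have -> : \sum_l (partial_within D l (christoffel D g l (@radial d) (@radial d)) (cyl_point i r p)
        - partial_within D (@radial d) (christoffel D g l (@radial d) l) (cyl_point i r p))
   = - (2^-1 * \tr dW).
  rewrite big_split_ord /= big_ord1.
  have E l : partial_within D l (christoffel D g l (@radial d) (@radial d)) (cyl_point i r p) = 0.
    by apply: (partial_within_cst _ (k := 0)) => // z; exact: christoffel_rr.
  rewrite !E subr0 add0r mulr_sumr -sumrN; apply: eq_bigr => l _.
  rewrite E sub0r; congr (- _); apply: partial_within_radial => //.
  apply: (near_eq_is_derive (f := fun s => 2^-1 *: W s l l)).
    by apply: filterS (radii_near ar) => s ars; rewrite christoffel_r.
  by apply: is_deriveZ; have /is_derive_mxP := dWr; apply.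
(* quadratic terms: only the products of tangential entries of W remain *)
have -> : \sum_l \sum_q (christoffel D g l l q (cyl_point i r p) *
       christoffel D g q (@radial d) (@radial d) (cyl_point i r p)
     - christoffel D g l (@radial d) q (cyl_point i r p) *
       christoffel D g q (@radial d) l (cyl_point i r p)) = - (4^-1 * \tr (W r *m W r)).
  rewrite big_split_ord /= big_ord1 big1 ?add0r; last first.
    by move=> q _; rewrite !christoffel_rr// !mulr0 subr0.
  rewrite mulr_sumr -sumrN; apply: eq_bigr => l _.
  rewrite big_split_ord /= big_ord1.
  rewrite christoffel_rr// mulr0 (christoffel_r_r _ ar) mulr0 subr0 add0r.
  rewrite mxE mulr_sumr -sumrN; apply: eq_bigr => q _.
  rewrite christoffel_rr// mulr0 sub0r !christoffel_r//; congr (- _).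
  by rewrite /W; field.
rewrite [\tr dW]linearB /= -/(W r).
by field.
Qed.

End Christoffel.

Lemma ricci_rrE (G : R -> tensor_field A) (p : N) (P P1 : R -> 'M[R]_d) (P2 : 'M[R]_d) r :
  (forall s, G s (chart_at A p) p = P s) ->
  (forall s, radii a b s -> P s \in unitmx) ->
  (forall s, radii a b s -> (P s)^T = P s) ->
  (forall s, radii a b s -> is_derive s 1 P (P1 s)) ->
  radii a b r -> is_derive r 1 P1 P2 ->
  ricci_rr a b G r p = - (2^-1 * \tr (invmx (P r) *m P2))
  + 4^-1 * \tr (invmx (P r) *m P1 r *m (invmx (P r) *m P1 r)).
Proof. by move=> *; apply: ricci_radial => //; exact: dom_chart_at. Qed.

End RadialRicci.

(** * Evolution of the radial mass *)

Section Evolution.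
Context {R : realType} {d : nat} {N : topologicalType}.
Variables (A : smooth_atlas R d N) (a b : \bar R).

Section Families.
Variables (G : R -> tensor_field A).
Hypothesis G_riem : cyl_riemannian a b G.

Lemma posdef_metric (T : tensor_field A) i p : riemannian_metric T ->
  chart_dom i p -> posdef (T i p).
Proof.
move=> T_riem ip; split; first exact: (Defs.metric_sym T_riem ip).
by move=> v; exact: (metric_pos T_riem ip).
Qed.

Lemma posdef_family i r p : radii a b r -> chart_dom i p -> posdef (G r i p).
Proof. by move=> ar; apply: posdef_metric; exact: G_riem.1. Qed.

Lemma family_derive i r p : radii a b r -> chart_dom i p ->
  is_derive r 1 (fun s => G s i p) (radial_jet G i 1 r p).
Proof.
move=> ar ip; have := radial_jet_derive G_riem 0%N ar ip.
by congr is_derive; apply/funext => s; rewrite radial_jet0.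
Qed.

Lemma jet1_sym i r p : radii a b r -> chart_dom i p ->
  (radial_jet G i 1 r p)^T = radial_jet G i 1 r p.
Proof.
move=> ar ip; apply: (is_derive_unique _ (family_derive ar ip)).
apply: near_eq_is_derive (is_derive_trmx (family_derive ar ip)).
by apply: filterS (radii_near ar) => s as_; have [] := posdef_family as_ ip.
Qed.

(** The transition jacobian is the same for all r, so the transformation rule
    can be differentiated in r. *)
Lemma jet1_transform i j r p : radii a b r -> chart_dom i p -> chart_dom j p ->
  radial_jet G i 1 r p =
  (transition_jacobian i j p)^T *m radial_jet G j 1 r p *m transition_jacobian i j p.
Proof.
move=> ar ip jp; set J := transition_jacobian i j p.
apply: (is_derive_unique (family_derive ar ip)).
have dJ : is_derive r 1 (fun s => J^T *m G s j p *m J) (J^T *m radial_jet G j 1 r p *m J).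
  have := is_derive_mulmx (is_derive_mulmx (is_derive_cst J^T r 1)
    (family_derive ar jp)) (is_derive_cst J r 1).
  by congr is_derive; rewrite mul0mx add0r mulmx0 addr0.
apply: near_eq_is_derive dJ; apply: filterS (radii_near ar) => s as_.
by rewrite (metric_transform (G_riem.1 s as_) ip jp).
Qed.

(** G times twice the deviation W - k of the Weingarten map from that of a warped
    product with h'/h = k. *)
Definition distortion (k : R) i r p : 'M[R]_d :=
  radial_jet G i 1 r p - (2 * k) *: G r i p.

(** Four times the trace of (W - k)^2. *)
Definition distortion_trace (k : R) i r p : R :=
  \tr (invmx (G r i p) *m distortion k i r p *m (invmx (G r i p) *m distortion k i r p)).

(** Twice the mean curvature, in an arbitrary chart. *)
Definition curvature_trace i r p : R := \tr (invmx (G r i p) *m radial_jet G i 1 r p).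

Lemma distortion_trace_ge0 k i r p : radii a b r -> chart_dom i p ->
  0 <= distortion_trace k i r p /\
  (distortion_trace k i r p = 0 -> radial_jet G i 1 r p = (2 * k) *: G r i p).
Proof.
move=> ar ip; have Gpos := posdef_family ar ip.
have [|? S0] := posdef_tr_sqr (S := distortion k i r p) Gpos.
  by rewrite linearB /= linearZ /= jet1_sym// Gpos.1.
by split=> // /S0/eqP; rewrite subr_eq0 => /eqP.
Qed.

(** Both quantities are traces of endomorphisms, which change by conjugation
    with the transition jacobian. *)
Lemma curvature_trace_chart i j r p : radii a b r -> chart_dom i p -> chart_dom j p ->
  curvature_trace i r p = curvature_trace j r p /\
  forall k, distortion_trace k i r p = distortion_trace k j r p.
Proof.
move=> ar ip jp; set J := transition_jacobian i j p.
have GE := metric_transform (G_riem.1 r ar) ip jp.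
have JE D := congr_invmx_mul (J := J) (P := G r j p) D.
have Gu : J^T *m G r j p *m J \in unitmx.
  by rewrite -GE; apply: posdef_unit; exact: posdef_family.
split.
  rewrite /curvature_trace GE (jet1_transform ar ip jp) (JE _ Gu).2.
  by rewrite tr_conj// (JE 0 Gu).1.
move=> k; have DE : distortion k i r p = J^T *m distortion k j r p *m J.
  rewrite /distortion GE (jet1_transform ar ip jp) mulmxBr mulmxBl.
  by rewrite -scalemxAr -scalemxAl.
have Ju := (JE 0 Gu).1.
rewrite /distortion_trace DE GE (JE _ Gu).2 -[RHS](tr_conj _ Ju); congr (\tr _).
by rewrite !mulmxA mulmxK.
Qed.

Lemma curvature_trace_cvg i r p : radii a b r -> chart_dom i p ->
  curvature_trace i z.1 z.2 @[z --> (r, p)] --> curvature_trace i r p /\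
  forall k : R -> R, k s @[s --> r] --> k r ->
  distortion_trace (k z.1) i z.1 z.2 @[z --> (r, p)] --> distortion_trace (k r) i r p.
Proof.
move=> ar ip.
have G0 : G z.1 i z.2 @[z --> (r, p)] --> G r i p.
  have := radial_jet_cvg G_riem (k := 0%N) ar ip.
  by under eq_cvg do rewrite radial_jet0; rewrite radial_jet0.
have G1 := radial_jet_cvg G_riem (k := 1%N) ar ip.
have Gu : \forall z \near (r, p), G z.1 i z.2 \in unitmx.
  have n1 : \forall w \near (r, p), radii a b w.1 by apply: cvg_fst (radii_near ar).
  have n2 : \forall w \near (r, p), chart_dom i w.2 by apply: cvg_snd (nbhs_chart_dom ip).
  by near=> z; apply: posdef_unit; apply: posdef_family; [near: z|near: z].
have Gi : invmx (G z.1 i z.2) @[z --> (r, p)] --> invmx (G r i p).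
  by apply: cvg_invmx => //; apply: posdef_unit; exact: posdef_family.
split; first by apply: cvg_mxtrace; apply: cvg_mulmx.
move=> k kr; have kz : k z.1 @[z --> (r, p)] --> k r.
  by apply: cvg_comp kr; exact: cvg_fst.
have Sz : distortion (k z.1) i z.1 z.2 @[z --> (r, p)] --> distortion (k r) i r p.
  apply: cvgB => //; apply: cvgZ => //.
  by apply: cvgM => //; exact: cvg_cst.
by apply: cvg_mxtrace; apply: cvg_mulmx; apply: cvg_mulmx.
Unshelve. all: by end_near. Qed.

End Families.

Section Warped.
Variables (h : R -> R).
Hypothesis h_gt0 : forall r, radii a b r -> 0 < h r.
Hypothesis h_smooth : forall k r, radii a b r -> derivable (derive1n k h) r 1.

(** The common principal curvature of the slices for the warped metric. *)
Definition log_slope r := derive1 h r / h r.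

Lemma warp_derive k r : radii a b r ->
  is_derive r 1 (derive1n k h) (derive1n k.+1 h r).
Proof. by move=> ar; split; [exact: h_smooth|rewrite derive1nS derive1E]. Qed.

Lemma warp_cvg k r : radii a b r -> derive1n k h s @[s --> r] --> derive1n k h r.
Proof.
move=> ar; have dh : derivable (derive1n k h) r 1 by exact: h_smooth.
by move/derivable1_diffP/differentiable_continuous : dh.
Qed.

Lemma log_slope_cvg r : radii a b r -> log_slope s @[s --> r] --> log_slope r.
Proof.
move=> ar; have h1 := warp_cvg (k := 1%N) ar; have h0 := warp_cvg (k := 0%N) ar.
by apply: (cvgM h1); apply: (cvgV _ h0); rewrite gt_eqF// h_gt0.
Qed.

Lemma warp_sqr_derive r : radii a b r ->
  is_derive r 1 (fun s => h s ^+ 2) (2 * (h r * derive1 h r)).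
Proof.
move=> ar; have dh := warp_derive 0%N ar.
rewrite (_ : (fun s => _) = h * h); last first.
  by apply/funext => s; rewrite expr2.
apply: (is_derive_eq (is_deriveM dh dh)).
by rewrite /GRing.scale /= mulr_natl mulr2n.
Qed.

Lemma warp_sqr_derive2 r : radii a b r ->
  is_derive r 1 (fun s => 2 * (h s * derive1 h s))
    (2 * (derive1 h r ^+ 2 + h r * derive1n 2 h r)).
Proof.
move=> ar; have dh := warp_derive 0%N ar; have dh1 := warp_derive 1%N ar.
apply: (is_derive_eq (is_deriveZ 2 (is_deriveM dh dh1))).
by rewrite /GRing.scale /= addrC expr2.
Qed.

Variables (T : tensor_field A) (T_riem : riemannian_metric T).

Lemma warped_mean_curvature r p : radii a b r ->
  mean_curvature (warped h T) r p = d%:R * log_slope r.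
Proof.
move=> ar; rewrite /mean_curvature /warped; set i := chart_at A p.
have Tu : T i p \in unitmx by apply/posdef_unit/posdef_metric => //; exact: dom_chart_at.
have -> : \matrix_(c, e) derive1 (fun s => (h s ^+ 2 *: T i p) c e) r
  = (2 * (h r * derive1 h r)) *: T i p.
  apply/matrixP => c e; rewrite mxE derive1E.
  have /is_derive_mxP/(_ c e)[_ ->] := is_derive_scalemx (T i p) (warp_sqr_derive ar).
  by [].
have h0 : h r != 0 by rewrite gt_eqF// h_gt0.
rewrite invmxZ ?unitmxZ ?unitfE ?expf_neq0// -scalemxAl -scalemxAr mulVmx// !mxtraceZ mxtrace1.
rewrite /log_slope; field.
by rewrite h0.
Qed.

Lemma warped_ricci r p : radii a b r ->
  ricci_rr a b (warped h T) r p = - (d%:R * (derive1n 2 h r / h r)).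
Proof.
move=> ar; set i := chart_at A p.
have Tpos : posdef (T i p) by apply/posdef_metric => //; exact: dom_chart_at.
have Tu := posdef_unit Tpos.
have hu s : radii a b s -> h s ^+ 2 \is a GRing.unit.
  by move=> as_; rewrite unitfE expf_neq0// gt_eqF// h_gt0.
have dP s : radii a b s -> is_derive s 1 (fun s => h s ^+ 2 *: T i p)
    ((2 * (h s * derive1 h s)) *: T i p).
  by move=> as_; apply: is_derive_scalemx; exact: warp_sqr_derive.
have dP1 := is_derive_scalemx (T i p) (warp_sqr_derive2 ar).
rewrite (ricci_rrE _ _ _ dP ar dP1) //.
- have h0 : h r != 0 by rewrite gt_eqF// h_gt0.
  rewrite invmxZ ?unitmxZ ?hu// -!scalemxAl -!scalemxAr !scalerA mulVmx//.
  rewrite mulmx1 scalerA !mxtraceZ mxtrace1; field.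
  by rewrite h0.
- by move=> s as_; rewrite unitmxZ// hu.
- by move=> s as_; rewrite linearZ /= Tpos.1.
Qed.

Variables (G : R -> tensor_field A).
Hypothesis G_riem : cyl_riemannian a b G.

(** The square h^2 tr ((W - k)^2) in the derivative of the mass. *)
Definition mass_defect r p : R :=
  h r ^+ 2 / 4 * distortion_trace G (log_slope r) (chart_at A p) r p.

Lemma radial_massE r p : radii a b r -> radial_mass h T G r p =
  h r ^+ 2 * (d%:R * log_slope r - 2^-1 * curvature_trace G (chart_at A p) r p).
Proof. by move=> ar; rewrite /radial_mass warped_mean_curvature. Qed.

Lemma ricci_excessE r p : radii a b r ->
  let i := chart_at A p in let X := invmx (G r i p) *m radial_jet G i 1 r p in
  ricci_excess a b h T G r p = h r ^+ 2 *
    (- (2^-1 * \tr (invmx (G r i p) *m radial_jet G i 2 r p)) + 4^-1 * \tr (X *m X)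
     + d%:R * (derive1n 2 h r / h r)).
Proof.
move=> ar i X; have ip : chart_dom i p by exact: dom_chart_at.
rewrite /ricci_excess warped_ricci// opprK.
have dP s : radii a b s -> is_derive s 1 (fun s => G s i p) (radial_jet G i 1 s p).
  by move=> as_; exact: family_derive.
rewrite (ricci_rrE _ _ _ dP ar (radial_jet_derive G_riem 1%N ar ip)) //.
- by move=> s as_; apply/posdef_unit/posdef_family.
- by move=> s as_; have [] := posdef_family G_riem as_ ip.
Qed.

Lemma distortion_traceE (P D : 'M[R]_d) k : P \in unitmx ->
  let X := invmx P *m D in
  \tr (invmx P *m (D - (2 * k) *: P) *m (invmx P *m (D - (2 * k) *: P))) =
  \tr (X *m X) - 4 * k * \tr X + 4 * k ^+ 2 * d%:R.
Proof.
move=> Pu X.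
have -> : invmx P *m (D - (2 * k) *: P) = X - (2 * k)%:M.
  by rewrite mulmxBr -scalemxAr mulVmx// scalemx1.
rewrite mulmxBl !mulmxBr mul_mx_scalar !mul_scalar_mx !linearB /= !mxtraceZ mxtrace_scalar.
by rewrite mulr_natr; ring.
Qed.

(** The terms in tr W combine with h^2 tr W^2 into a square because (h^2)' = 2 h^2 k;
    the second derivatives of G and h are those of the Ricci excess. *)
Lemma radial_mass_derive r p : radii a b r ->
  is_derive r 1 (radial_mass h T G ^~ p) (mass_defect r p + ricci_excess a b h T G r p).
Proof.
move=> ar; set i := chart_at A p; have ip : chart_dom i p by exact: dom_chart_at.
have h0 : h r != 0 by rewrite gt_eqF// h_gt0.
have Gu : G r i p \in unitmx by apply/posdef_unit/posdef_family.
have dh := warp_derive 0%N ar; have dh1 := warp_derive 1%N ar.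
pose X := invmx (G r i p) *m radial_jet G i 1 r p.
have dX : is_derive r 1 (fun s => curvature_trace G i s p)
    (\tr (invmx (G r i p) *m radial_jet G i 2 r p) - \tr (X *m X)).
  have Gun : \forall s \near r, G s i p \in unitmx.
    by apply: filterS (radii_near ar) => s as_; apply/posdef_unit/posdef_family.
  have := is_derive_mxtrace (is_derive_mulmx (is_derive_invmx Gun (family_derive G_riem ar ip))
    (radial_jet_derive G_riem 1%N ar ip)).
  by congr is_derive; rewrite mulNmx linearD linearN /= addrC /X !mulmxA.
have dk : is_derive r 1 log_slope (derive1n 2 h r / h r - log_slope r ^+ 2).
  have := is_deriveM dh1 (is_deriveV h0 dh); congr is_derive.
  rewrite /log_slope /GRing.scale /=; field.
  by rewrite h0.
have := is_deriveM (warp_sqr_derive ar) (is_deriveB (is_deriveZ d%:R dk) (is_deriveZ 2^-1 dX)).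
move=> dm; apply: near_eq_is_derive (is_derive_eq dm _).
  by apply: filterS (radii_near ar) => s as_; rewrite radial_massE.
rewrite ricci_excessE// -/i -/X /mass_defect -/i /distortion_trace /distortion.
rewrite distortion_traceE// -/X.
have -> : (d%:R \*: log_slope - 2^-1 \*: (curvature_trace G i)^~ p) r
  = d%:R * log_slope r - 2^-1 * \tr X by [].
rewrite /log_slope.
move: (\tr X) (\tr (X *m X)) (\tr _) (derive1 h r) (derive1n 2 h r) h0 => x1 x2 x3 h1 h2 h0.
rewrite /GRing.scale /=; field.
by rewrite h0.
Qed.

End Warped.
End Evolution.

(** * Finiteness and positivity of the Riemannian measure *)

Section IteratedIntegral.
Context {R : realType}.

Lemma lebesgue_iint_ge0 d (f : 'rV[R]_d -> \bar R) :
  (forall y, 0 <= f y)%E -> (0 <= lebesgue_iint f)%E.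
Proof.
elim: d f => [|d IHd] f f0 /=; first exact: f0.
by apply: integral_ge0 => x _; exact: IHd.
Qed.

(** The integral of a nonnegative function is a supremum over the simple functions
    below it, hence monotone for arbitrary functions. *)
Lemma le_lebesgue_iint d (f g : 'rV[R]_d -> \bar R) :
  (forall y, 0 <= f y)%E -> (forall y, f y <= g y)%E ->
  (lebesgue_iint f <= lebesgue_iint g)%E.
Proof.
elim: d f g => [|d IHd] f g f0 fg /=; first exact: fg.
have g0 y : (0 <= g y)%E by apply: le_trans (fg y).
rewrite !ge0_integralTE; last 2 first.
- by move=> x; apply: lebesgue_iint_ge0.
- by move=> x; apply: lebesgue_iint_ge0.
apply: le_ereal_sup => _ [u uf <-]; exists u => // x.
by apply: le_trans (uf x) _; apply: IHd.
Qed.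

(** Based at its lower corner, so that a cube on a point of the closed half-space
    stays in it. *)
Definition cube d (l : 'rV[R]_d) (e : R) : set 'rV[R]_d :=
  [set y | forall c, l 0 c <= y 0 c <= l 0 c + e].

Lemma cube_row_mx d (l : 'rV[R]_(1 + d)) e (x : R) (y : 'rV[R]_d) :
  \1_(cube l e) (row_mx x%:M y) =
  \1_(`[l 0 (lshift d 0), l 0 (lshift d 0) + e]%classic) x * \1_(cube (rsubmx l) e) y :> R.
Proof.
rewrite !indicE -natrM mulnb; congr (_%:R); congr nat_of_bool.
apply/idP/andP; rewrite !inE /cube /= in_itv /=.
  move=> H; split; first by have := H (lshift d 0); rewrite row_mxEl mxE eqxx.
  by move=> c; have := H (rshift 1 c); rewrite row_mxEr !mxE.
move=> [H1 H2] c; case: (split_ordP c) => k ->.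
  by rewrite row_mxEl mxE !ord1 eqxx.
by have := H2 k; rewrite row_mxEr !mxE.
Qed.

Lemma lebesgue_iint_cube d (l : 'rV[R]_d) (e k : R) : 0 < e -> 0 <= k ->
  lebesgue_iint (fun y => (k * \1_(cube l e) y)%:E) = (k * e ^+ d)%:E.
Proof.
move=> e0; elim: d l k => [|d IHd] l k k0.
  by rewrite /= indicE mem_set ?mulr1// => -[].
pose l' : 'rV[R]_(1 + d) := l; pose I := `[l' 0 (lshift d 0), l' 0 (lshift d 0) + e]%classic.
transitivity (\int[lebesgue_measure]_x ((k * e ^+ d)%:E * (\1_I x)%:E))%E.
  apply: eq_integral => x _.
  rewrite -EFinM mulrAC -(IHd (rsubmx l')); last by rewrite mulr_ge0// indicE.
  congr lebesgue_iint; apply/funext => y.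
  by rewrite (cube_row_mx l') mulrA.
rewrite ge0_integralZl//; last 2 first.
- by apply/measurable_EFinP; apply: measurable_indic; exact: measurable_itv.
- by rewrite lee_fin mulr_ge0// exprn_ge0// ltW.
rewrite /I integral_indic//= setIT lebesgue_measure_itv /= lte_fin ltrDl e0.
by rewrite -EFinD -EFinM addrAC subrr add0r -mulrA -exprSr.
Qed.

End IteratedIntegral.

Section RiemannianMeasure.
Context {R : realType} {d : nat} {N : ptopologicalType}.
Variables (A : smooth_atlas R d N).

Lemma open_borel (V : set N) : open V -> measurable (V : set (borel_type N)).
Proof. by move=> Vo; apply: sub_sigma_algebra. Qed.

Variables (T : tensor_field A) (T_riem : riemannian_metric T).

Lemma metric_cvg i p : chart_dom i p -> T i q @[q --> p] --> T i p.
Proof.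
move=> ip; apply/cvg_mxP => c e.
have ip' : (phi i @` chart_dom i) (phi i p) by exists p.
have [U [F [Uo Up Fs FE]]] := metric_smooth T_riem c e ip'.
have TF q : chart_dom i q -> U (phi i q) -> T i q c e = F (phi i q).
  by move=> iq Uq; rewrite -FE ?phiK//; exists q.
have Up' : \forall q \near p, U (phi i q).
  by apply: (phi_cvg ip); apply: open_nbhs_nbhs.
rewrite TF//; apply: (@cvg_trans _ ((fun q => F (phi i q)) @ p)).
  apply: near_eq_cvg; near=> q; rewrite TF//; near: q => //.
  exact: nbhs_chart_dom.
have [Fc _] := Fs [::] _ Up.
exact: (cvg_comp _ _ (phi_cvg ip) Fc).
Unshelve. all: by end_near. Qed.

Let density i p := Num.sqrt (\det (T i p)).

Lemma density_cvg i p : chart_dom i p -> density i q @[q --> p] --> density i p.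
Proof.
move=> ip; have detT : \det (T i q) @[q --> p] --> \det (T i p).
  exact: cvg_det (metric_cvg ip).
exact: (cvg_comp _ _ detT (@sqrt_continuous R _)).
Qed.

Lemma density_gt0 i p : chart_dom i p -> 0 < density i p.
Proof.
move=> ip; rewrite sqrtr_gt0.
have [L /(congr1 determinant)] := posdef_congr (posdef_metric T_riem ip).
rewrite !det_mulmx det_tr det1 => LP.
have L0 : \det L != 0.
  by apply: contra_eq_neq LP => ->; rewrite !mul0r eq_sym oner_eq0.
rewrite -(pmulr_rgt0 (x := \det L ^+ 2)); last by rewrite exprn_even_gt0.
by rewrite expr2 mulrAC LP.
Qed.

Variables (mu : {measure set (borel_type N) -> \bar R}).
Hypothesis mu_T : riemannian_measure T mu.

(** Near p the density is bounded and the chart takes values in a cube. *)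
Lemma riemannian_measure_locally_finite p :
  exists V : set N, [/\ open V, V p & (mu V < +oo)%E].
Proof.
pose i := chart_at A p; have ip : chart_dom i p by exact: dom_chart_at.
pose C := density i p + 1; pose l := phi i p - const_mx 1.
pose W := [set q | [/\ chart_dom i q, density i q <= C & cube l 2 (phi i q)]].
have Wp : nbhs p W.
  have n1 := nbhs_chart_dom ip.
  have n2 : \forall q \near p, density i q < C.
    by apply: (cvgr_lt _ (density_cvg ip)); rewrite ltrDl.
  have n3 : \forall q \near p, forall c, `|phi i p 0 c - phi i q 0 c| < 1.
    apply: filter_forall => c; have /cvg_mxP/(_ 0 c) := phi_cvg ip.
    by move/cvgrPdist_lt; apply.
  near=> q; split.
  - by near: q.
  - by apply: ltW; near: q.
  - move=> c; rewrite !mxE.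
    have : `|phi i p 0 c - phi i q 0 c| < 1 by move: c; near: q.
    by rewrite ltr_norml => /andP[? ?]; apply/andP; split; lra.
have C0 : 0 <= C by rewrite addr_ge0// ltW// density_gt0.
exists W°; split; [exact: open_interior|exact: Wp|].
have WS : W° `<=` W by exact: interior_subset.
rewrite (mu_T (i := i)); last 2 first.
- by apply: open_borel; exact: open_interior.
- by move=> q /WS[].
apply: (@le_lt_trans _ _ (lebesgue_iint (fun y => (C * \1_(cube l 2) y)%:E))).
  apply: le_lebesgue_iint => y.
    by rewrite lee_fin mulr_ge0// sqrtr_ge0.
  rewrite lee_fin indicE; case: (boolP (_ \in _)) => [|_]; last first.
    by rewrite mul0r mulr_ge0.
  rewrite inE => -[q Wq <-]; have [iq qC lq] := WS _ Wq.
  by rewrite phiK// mul1r indicE mem_set// mulr1.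
by rewrite lebesgue_iint_cube// ltry.
Unshelve. all: by end_near. Qed.

Lemma riemannian_measure_finite : compact [set: N] -> (mu setT < +oo)%E.
Proof.
rewrite compact_cover => N_compact.
have [V VP] := choice riemannian_measure_locally_finite.
have Vo p : [set: N] p -> open (V p) by have [] := VP p.
have [E finE ET] : exists2 E : set N, finite_set E & [set: N] `<=` \bigcup_(p in E) V p.
  have [|D _ DT] := N_compact _ setT V Vo.
    by move=> p _; exists p => //; have [] := VP p.
  by eexists; [exact: finite_fset|exact: DT].
have mV p : measurable (V p : set (borel_type N)).
  by apply: open_borel; have [] := VP p.
have : (mu setT <= \sum_(p \in E) mu (V p))%E by exact: content_sub_fsum.
move/le_lt_trans; apply; rewrite fsbig_finite//=; apply: lte_sum_pinfty => p _.
by have [] := VP p.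
Qed.

(** The chart image of the open set contains a cube with a corner at the image of
    p, on which the density is bounded below; the corner matters if p lies on the
    boundary. *)
Lemma riemannian_measure_open_gt0 (V : set N) : open V -> V !=set0 -> (0 < mu V)%E.
Proof.
move=> Vo [p Vp]; pose i := chart_at A p; have ip : chart_dom i p by exact: dom_chart_at.
pose c := density i p / 2; have c0 : 0 < c by rewrite divr_gt0// density_gt0.
pose W := [set q | [/\ V q, chart_dom i q & c <= density i q]].
have Wp : W° p.
  rewrite /interior; near=> q; split.
  - by near: q; apply: open_nbhs_nbhs.
  - by near: q; exact: nbhs_chart_dom.
  - apply: ltW; near: q; apply: (cvgr_gt _ (density_cvg ip)).
    by rewrite ltr_pdivrMr// ltr_pMr ?ltr1n// density_gt0.
have WS : W° `<=` W by exact: interior_subset.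
have mW : measurable (W° : set (borel_type N)) by apply: open_borel; exact: open_interior.
apply: (@lt_le_trans _ _ (mu W°)); last first.
  by apply: le_measure; rewrite ?inE//; [exact: open_borel|move=> q /WS[]].
have [U Uo UE] := image_open i.
pose y0 := phi i p.
have y0U : (phi i @` chart_dom i) y0 by exists p.
have [e e0 eW] : exists2 e, 0 < e & cube y0 e `<=` phi i @` W°.
  have /subspace_continuousP/(_ y0 y0U) psi_cvg := @psi_continuous _ _ _ A i.
  have psiW : nbhs (psi i y0) W°.
    by rewrite phiK//; apply: open_nbhs_nbhs; split => //; exact: open_interior.
  have near_psi : \forall y \near y0, (phi i @` chart_dom i) y -> W° (psi i y).
    exact: psi_cvg psiW.
  have /nbhs_ballP[e /= e0 eB] : \forall y \near y0, U y /\ (half_space y -> W° (psi i y)).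
    have Uy0 : \forall y \near y0, U y.
      by apply: open_nbhs_nbhs; split => //; move: y0U; rewrite UE => -[].
    near=> y; have Uy : U y by near: y.
    split=> // Hy; have : (phi i @` chart_dom i) y by rewrite UE.
    by near: y.
  exists (e / 2); first by rewrite divr_gt0.
  move=> y yc; have [|Uy Wy] := eB y.
    split => // j k; rewrite ord1 /ball /=.
    have := yc k; rewrite ltr_norml => /andP[? ?]; apply/andP; split; lra.
  have Hy : half_space y.
    move=> k kd; have /andP[+ _] := yc k; apply: le_trans.
    by move: y0U; rewrite UE => -[_]; exact.
  have : (phi i @` chart_dom i) y by rewrite UE.
  move=> [q iq qy]; exists q => //; have := Wy Hy.
  by rewrite -qy phiK.
rewrite (mu_T (i := i))//; last by move=> q /WS[].
apply: (@lt_le_trans _ _ (lebesgue_iint (fun y => (c * \1_(cube y0 e) y)%:E))).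
  by rewrite lebesgue_iint_cube ?ltW// lte_fin mulr_gt0// exprn_gt0.
apply: le_lebesgue_iint => y.
  by rewrite lee_fin mulr_ge0// ltW.
rewrite lee_fin indicE; case: (boolP (_ \in _)) => [|_]; last first.
  by rewrite mulr0 mulr_ge0// sqrtr_ge0.
rewrite inE => /eW[q Wq <-]; have [_ iq cq] := WS _ Wq.
by rewrite phiK// mulr1 indicE mem_set ?mul1r//; exists q.
Unshelve. all: by end_near. Qed.

End RiemannianMeasure.

(** * Measurability and integration on the cylinder *)

Section ProductMeasurability.
Context {R : realType} {N : ptopologicalType}.
Hypothesis N_countable : @second_countable N.

(** O is the countable union, over the basic open sets V of N, of the products
    with V of the interior of the set of the r such that {r} x V lies in O. *)
Lemma open_product_measurable (O : set (R * N)) : open O ->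
  measurable (O : set (R * borel_type N)).
Proof.
move=> Oo; have [B Bc [Bo Bx]] := N_countable.
pose I (V : set N) : set R := interior [set r | forall q, V q -> O (r, q)].
have OE : O = \bigcup_(V in B) (I V `*` V).
  apply/seteqP; split => [[r p] Orp|[r p] [V BV [/interior_subset /= rV Vp]]]; last exact: rV.
  have : nbhs (r, p) O by exact: open_nbhs_nbhs.
  move=> [[X Y] [/= rX pY] XYO].
  have [V [BV Vp] VY] := Bx p Y pY.
  exists V => //; split=> //=; rewrite /I /interior.
  by apply: filterS rX => s Xs q Vq; apply: XYO; split => //; exact: VY.
have mIV V : B V -> measurable (I V `*` V : set (R * borel_type N)).
  move=> BV; apply: measurableX.
    by apply: open_measurable; exact: open_interior.
  by apply: open_borel; exact: Bo.
rewrite OE; have [->|[F]] := pfcard_geP Bc.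
  by rewrite bigcup_set0; exact: measurable0.
have -> : \bigcup_(V in B) (I V `*` V) = \bigcup_k (I (F k) `*` F k).
  apply/seteqP; split => [z [V BV zV]|z [k _ zk]].
    by have [k _ kV] := 'surj_F BV; exists k => //; rewrite kV.
  by exists (F k) => //; exact: funS.
by apply: bigcupT_measurable => k; apply: mIV; exact: funS.
Qed.

Lemma cvg_measurable_fun (D : set R) (f : R -> N -> R) : open D ->
  (forall r p, D r -> f z.1 z.2 @[z --> (r, p)] --> f r p) ->
  measurable_fun (D `*` setT : set (R * borel_type N)) (fun z => f z.1 z.2).
Proof.
move=> Do fc; apply: (measurability _ (RGenOpens.measurableE R)).
move=> _ [_ [x [y ->] <-]]; apply: open_product_measurable.
rewrite openE => -[r p] [/= [Dr _] fxy].
have Dn : \forall z \near (r, p), D z.1.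
  by apply: (cvg_fst : z.1 @[z --> (r, p)] --> r); exact: open_nbhs_nbhs.
have fn : \forall z \near (r, p), `]x, y[%classic (f z.1 z.2).
  apply: (fc r p Dr); apply: open_nbhs_nbhs; split; last exact: fxy.
  exact: interval_open.
by apply: filterS2 Dn fn => z Dz fz; split.
Qed.

Lemma cvg_measurable_funT (f : N -> R) : (forall p, f q @[q --> p] --> f p) ->
  measurable_fun [set: borel_type N] f.
Proof.
move=> fc; apply: (measurability _ (RGenOpens.measurableE R)).
move=> _ [_ [x [y ->] <-]]; rewrite setTI; apply: open_borel.
rewrite openE => p fxy; apply: (fc p); apply: open_nbhs_nbhs; split; last exact: fxy.
exact: interval_open.
Qed.

End ProductMeasurability.

Section SliceIntegration.
Context d1 d2 {T1 : measurableType d1} {T2 : measurableType d2} {R : realType}.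
Variables (m1 : {sigma_finite_measure set T1 -> \bar R}).
Variables (m2 : {sigma_finite_measure set T2 -> \bar R}).
Variables (D : set T1) (Q E : T1 -> T2 -> R) (f : T2 -> R).
Hypothesis mD : measurable D.
Hypothesis Q_ge0 : forall r p, D r -> 0 <= Q r p.
Hypothesis Q_meas : measurable_fun (D `*` setT) (fun z => Q z.1 z.2).
Hypothesis E_int : (m1 \x m2)%E.-integrable (D `*` setT) (fun z => (E z.1 z.2)%:E).
Hypothesis Q_slice : forall p, m1.-integrable D (fun r => (Q r p)%:E).
Hypothesis E_slice : forall p, m1.-integrable D (fun r => (E r p)%:E).
Hypothesis QE_slice : forall p, (\int[m1]_(r in D) (Q r p + E r p)%:E = (f p)%:E)%E.
Hypothesis f_int : m2.-integrable setT (EFin \o f).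

Let mDT : measurable (D `*` [set: T2]).
Proof. exact: measurableX. Qed.

Let EI := (fun z : T1 * T2 => (E z.1 z.2)%:E) \_ (D `*` setT).
Let QI := (fun z : T1 * T2 => (Q z.1 z.2)%:E) \_ (D `*` setT).

Let EI_int : (m1 \x m2)%E.-integrable setT EI.
Proof. by move: E_int; rewrite integrable_mkcond. Qed.

Let EI_meas : measurable_fun setT EI.
Proof. exact: measurable_int EI_int. Qed.

Let QI_meas : measurable_fun setT QI.
Proof. by apply/(measurable_restrictT _ mDT); apply/measurable_EFinP. Qed.

Let QI_ge0 z : (0 <= QI z)%E.
Proof.
rewrite /QI /patch; case: ifPn => //; rewrite inE => -[/= zD _].
by rewrite lee_fin Q_ge0.
Qed.

Let slice_restrict (g : T1 -> T2 -> R) p :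
  (\int[m1]_r ((fun z : T1 * T2 => (g z.1 z.2)%:E) \_ (D `*` setT)) (r, p)
   = \int[m1]_(r in D) (g r p)%:E)%E.
Proof.
rewrite [RHS]integral_mkcond; apply: eq_integral => r _.
rewrite /patch; congr (if _ then _ else _).
by apply/idP/idP; rewrite !inE /=; [case|].
Qed.

Let EG p := (\int[m1]_r EI (r, p))%E.

Let EG_int : m2.-integrable setT EG.
Proof.
apply/integrableP; split; first exact: (measurable_fubini_G EI_int).
have lt1 := (integrable21ltyP m1 m2 EI_meas).1 EI_int.
apply: le_lt_trans lt1; apply: ge0_le_integral => //.
- by apply: measurableT_comp => //; exact: (measurable_fubini_G EI_int).
- by apply: (measurable_fun_fubini_tonelli_G (abse \o EI)) => //=; exact: measurableT_comp.
- move=> p _; apply: le_abse_integral => //.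
  by apply: measurableT_comp => //; exact: measurable_pair2.
Qed.

(** Fubini applies to E, which is integrable; Q is nonnegative, so Tonelli computes
    its integral from the slices, where it is f minus the integral of E. *)
Lemma slice_integration :
  (\int[(m1 \x m2)%E]_(z in D `*` setT) (Q z.1 z.2)%:E =
   (\int[m2]_(p in setT) f p
    - \int[(m1 \x m2)%E]_(z in D `*` setT) E z.1 z.2)%:E)%E.
Proof.
have QE p : (\int[m1]_r QI (r, p) = (f p)%:E - EG p)%E.
  rewrite /EG !slice_restrict -QE_slice.
  under [X in (X - _)%E]eq_integral do rewrite EFinD.
  by rewrite integralD// addeK//; exact: integrable_fin_num.
rewrite integral_mkcond fubini_tonelli2//.
under eq_integral do rewrite /fubini_G QE.
rewrite integralB// EFinB; congr (_ - _)%E.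
  by rewrite fineK//; exact: integrable_fin_num.
rewrite (integral21_prod_meas1 EI_int) -integral_mkcond.
by rewrite fineK//; exact: integrable_fin_num.
Qed.

End SliceIntegration.

Section IntegratedEvolution.
Context {R : realType} {N : ptopologicalType}.
Variable mu : {sigma_finite_measure set (borel_type N) -> \bar R}.
Variables (m Q E : R -> N -> R) (al be : R).
Hypothesis al_be : al < be.
Let I := `[al, be]%classic : set R.
Hypothesis m_derive : forall r p, al <= r <= be ->
  is_derive r 1 (m ^~ p) (Q r p + E r p).
Hypothesis Q_cvg : forall r p, al <= r <= be -> Q s p @[s --> r] --> Q r p.
Hypothesis E_cvg : forall r p, al <= r <= be -> E s p @[s --> r] --> E r p.
Hypothesis m_int : forall r, al <= r <= be -> mu.-integrable setT (EFin \o m r).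
Hypothesis Q_ge0 : forall r p, al <= r <= be -> 0 <= Q r p.
Hypothesis Q_meas : measurable_fun (I `*` setT) (fun z : R * borel_type N => Q z.1 z.2).
Hypothesis E_int :
  (lebesgue_measure \x mu)%E.-integrable (I `*` setT) (fun z => (E z.1 z.2)%:E).

Let in_I r : r \in `[al, be] -> al <= r <= be.
Proof. by rewrite in_itv. Qed.

(** The fundamental theorem of calculus on each radial line. *)
Lemma slice_integral p :
  (\int[lebesgue_measure]_(r in I) (Q r p + E r p)%:E = (m be p - m al p)%:E)%E.
Proof.
have m_cont r : al <= r <= be -> m s p @[s --> r] --> m r p.
  by move=> /m_derive-/(_ p)[/derivable1_diffP/differentiable_continuous].
rewrite (continuous_FTC2 (F := m ^~ p)) ?EFinB//.
- apply/subspace_continuousP => r /= /in_I rI.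
  by apply: cvg_within_filter; apply: cvgD; [exact: Q_cvg|exact: E_cvg].
- split.
  + move=> r /subset_itv_oo_cc /in_I /m_derive-/(_ p) [dm _]; exact: dm.
  + by apply: cvg_at_right_filter; apply: m_cont; rewrite lexx ltW.
  + by apply: cvg_at_left_filter; apply: m_cont; rewrite lexx ltW.
- move=> r /subset_itv_oo_cc /in_I /m_derive-/(_ p) [_ dm].
  by rewrite derive1E.
Qed.

Lemma slice_integrable (f : R -> R) : (forall r, al <= r <= be -> f s @[s --> r] --> f r) ->
  lebesgue_measure.-integrable I (EFin \o f).
Proof.
move=> fc; apply: continuous_compact_integrable; first exact: segment_compact.
by apply/subspace_continuousP => r /= /in_I rI; apply: cvg_within_filter; exact: fc.
Qed.

Lemma integral_evolution :
  (\int[(lebesgue_measure \x mu)%E]_(z in I `*` setT) (Q z.1 z.2)%:E =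
   (\int[mu]_(p in setT) m be p - \int[mu]_(p in setT) m al p
    - \int[(lebesgue_measure \x mu)%E]_(z in I `*` setT) E z.1 z.2)%:E)%E.
Proof.
have al_in : al <= al <= be by rewrite lexx ltW.
have be_in : al <= be <= be by rewrite lexx ltW.
have mbe := m_int be_in; have mal := m_int al_in.
pose f : borel_type N -> R := fun p => m be p - m al p.
have f_int : mu.-integrable setT (EFin \o f).
  by have := integrableB (measurableT : measurable [set: borel_type N]) mbe mal.
have QI0 r p : I r -> 0 <= Q r p by rewrite /I /= in_itv => /Q_ge0.
have Q_slice p := slice_integrable (fun r => @Q_cvg r p).
have E_slice p := slice_integrable (fun r => @E_cvg r p).
have mI : measurable I by exact: measurable_itv.
rewrite (@slice_integration _ _ _ _ R lebesgue_measure mu I Q E f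
  mI QI0 Q_meas E_int Q_slice E_slice slice_integral f_int).
by rewrite /f RintegralB.
Qed.

End IntegratedEvolution.

(** * Exhaustion of the radial interval *)

Section Exhaustion.
Context {R : realType}.

Lemma seq_to_lower (e : \bar R) (c : R) : (e < c%:E)%E ->
  exists u : nat -> R, (forall k, (e < (u k)%:E < c%:E)%E) /\
    (u k)%:E @[k --> \oo] --> e.
Proof.
case: e => [x||] //; rewrite ?lte_fin => xc.
- exists (fun k => x + (c - x) / 2 * harmonic k); split.
    move=> k; have k0 : 0 < (k.+1%:R : R)^-1 by rewrite invr_gt0.
    have k1 : (k.+1%:R : R)^-1 <= 1 by rewrite invf_le1// ler1n.
    have cx : 0 < (c - x) / 2 by lra.
    have h1 : 0 < (c - x) / 2 * harmonic k by rewrite mulr_gt0.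
    have h2 : (c - x) / 2 * harmonic k <= (c - x) / 2 by rewrite ler_piMr// ltW.
    by rewrite !lte_fin; apply/andP; split; lra.
  apply: cvg_EFin; first by apply: nearW.
  rewrite -[X in _ --> X]addr0; apply: cvgD; first exact: cvg_cst.
  rewrite -[X in _ --> X](mulr0 ((c - x) / 2)).
  by apply: cvgM; [exact: cvg_cst|exact: cvg_harmonic].
- exists (fun k => c - 1 - k%:R); split.
    by move=> k; rewrite ltNyr lte_fin /=; have : 0 <= (k%:R : R) by []; lra.
  apply/cvgeNyPle => M; near=> k; rewrite lee_fin.
  have : c - M <= k%:R by near: k; exact: nbhs_infty_ger.
  lra.
Unshelve. all: by end_near. Qed.

Variables (a b : \bar R).
Hypothesis ab : (a < b)%E.

Lemma radii_nonempty : exists c, radii a b c.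
Proof.
case: a b ab => [x||] [y||] //; rewrite ?lte_fin => xy.
- by exists ((x + y) / 2); rewrite /radii /= !lte_fin; apply/andP; split; lra.
- by exists (x + 1); rewrite /radii /= lte_fin ltry ltrDl ltr01.
- by exists (y - 1); rewrite /radii /= lte_fin ltNyr gtrBl ltr01.
- by exists 0; rewrite /radii /= ltNyr ltry.
Qed.

(** Reduces limits along the filters at both ends, and integrals over the whole
    interval, to sequences of compact intervals. *)
Lemma radii_exhaustion : exists al be : nat -> R,
  [/\ forall k, [/\ radii a b (al k), radii a b (be k) & al k < be k],
      al k @[k --> \oo] --> nbhs_in a b a,
      be k @[k --> \oo] --> nbhs_in a b b &
      forall r, radii a b r -> \forall k \near \oo, al k <= r <= be k].
Proof.
have [c /andP[ac cb]] := radii_nonempty.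
have [al [al_in al_a]] := seq_to_lower ac.
have Ncb : (- b < (- c)%:E)%E by rewrite EFinN lteN2.
have [be' [be'_in be'_b]] := seq_to_lower Ncb.
pose be k := - be' k.
have be_in k : (c%:E < (be k)%:E < b)%E.
  have /andP[b1 b2] := be'_in k; rewrite /be EFinN; apply/andP; split.
    by rewrite lteNr -EFinN.
  by rewrite lteNl.
have be_b : (be k)%:E @[k --> \oo] --> b.
  rewrite -(oppeK b); apply: (@cvg_trans _ ((fun k => - (be' k)%:E)%E @ \oo)).
    by apply: near_eq_cvg; apply: nearW => k.
  exact: cvgeN.
have al_r k : radii a b (al k).
  have /andP[a1 a2] := al_in k; apply/andP; split => //; exact: lt_trans cb.
have be_r k : radii a b (be k).
  have /andP[b1 b2] := be_in k; apply/andP; split => //; exact: lt_trans b1.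
have to_in (u : nat -> R) e : (forall k, radii a b (u k)) ->
    (u k)%:E @[k --> \oo] --> e -> u k @[k --> \oo] --> nbhs_in a b e.
  move=> ur ue B eB.
  have : \forall k \near \oo, forall r, (u k)%:E = r%:E -> radii a b r -> B r.
    exact: ue eB.
  by apply: filterS => k; apply.
exists al, be; split; [|exact: to_in|exact: to_in|].
  move=> k; split => //.
  have /andP[_ a2] := al_in k; have /andP[b1 _] := be_in k.
  by rewrite -lte_fin; exact: lt_trans b1.
move=> r /andP[ar rb].
have n1 : \forall k \near \oo, ((al k)%:E < r%:E)%E 
  by apply: (al_a [set e | (e < r%:E)%E]); apply: open_nbhs_nbhs;
    split => //; exact: open_ereal_lt_ereal.
have n2 : \forall k \near \oo, (r%:E < (be k)%:E)%E 
  by apply: (be_b [set e | (r%:E < e)%E]); apply: open_nbhs_nbhs;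
    split => //; exact: open_ereal_gt_ereal.
near=> k; apply/andP; split; apply: ltW; rewrite -lte_fin; by near: k.
Unshelve. all: by end_near. Qed.

(** Turns a limit at r0, an inner point or an end of the interval, into a statement
    about an actual radius. *)
Lemma nbhs_in_ex (r0 : \bar R) B : (a <= r0 <= b)%E -> nbhs_in a b r0 B ->
  exists2 r, radii a b r & B r.
Proof.
move=> /andP[ar0 r0b] nB.
have [al [be [ab_in al_a be_b _]]] := radii_exhaustion.
have [r0a|r0a] := eqVneq r0 a.
  rewrite r0a in nB; have [k Bk] := filter_ex (al_a _ nB : \forall k \near \oo, B (al k)).
  by exists (al k) => //; have [] := ab_in k.
have [r0b'|r0b'] := eqVneq r0 b.
  rewrite r0b' in nB; have [k Bk] := filter_ex (be_b _ nB : \forall k \near \oo, B (be k)).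
  by exists (be k) => //; have [] := ab_in k.
have {}ar0 : (a < r0)%E by rewrite lt_neqAle eq_sym r0a.
have {}r0b : (r0 < b)%E by rewrite lt_neqAle r0b'.
have r0fin : r0 \is a fin_num.
  by rewrite fin_numE; apply/andP; split; [rewrite gt_eqF//; apply: le_lt_trans ar0|
     rewrite lt_eqF//; apply: lt_le_trans r0b _]; rewrite ?leNye ?leey.
have r0r : radii a b (fine r0) by rewrite /radii /= fineK// ar0.
by exists (fine r0) => //; apply: (nbhs_singleton nB) => //; rewrite fineK.
Qed.

End Exhaustion.

(** * Mass balance on compact pieces *)

Section MassInequality.
Context {R : realType} {d : nat} {N : ptopologicalType}.
Variables (A : smooth_atlas R d N) (a b : \bar R).
Hypothesis N_countable : @second_countable N.
Hypothesis N_compact : compact [set: N].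
Hypothesis ab : (a < b)%E.
Variables (h : R -> R).
Hypothesis h_gt0 : forall r, radii a b r -> 0 < h r.
Hypothesis h_smooth : forall k r, radii a b r -> derivable (derive1n k h) r 1.
Variables (Ghat : tensor_field A) (Ghat_metric : riemannian_metric Ghat).
Variable mu : {sigma_finite_measure set (borel_type N) -> \bar R}.
Hypothesis mu_Ghat : riemannian_measure Ghat mu.
Variables (G : R -> tensor_field A) (g_metric : cyl_riemannian a b G).

Let m := radial_mass h Ghat G.
Let Q := mass_defect h G.
Let E := ricci_excess a b h Ghat G.

Lemma mass_defect_ge0 r p : radii a b r -> 0 <= Q r p.
Proof.
move=> ar; rewrite /Q /mass_defect mulr_ge0 ?divr_ge0 ?sqr_ge0//.
by have [] := distortion_trace_ge0 g_metric (log_slope h r) ar (dom_chart_at A p).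
Qed.

Lemma near_chart (i : chart A) r p : radii a b r -> chart_dom i p ->
  \forall z \near (r, p), radii a b z.1 /\ chart_dom i z.2.
Proof.
move=> ar ip.
have n1 : \forall w \near (r, p), radii a b w.1 by apply: cvg_fst (radii_near ar).
have n2 : \forall w \near (r, p), chart_dom i w.2 by apply: cvg_snd (nbhs_chart_dom ip).
by apply: filterS2 n1 n2.
Qed.

Lemma warp_sqr_cvg r : radii a b r -> h s ^+ 2 @[s --> r] --> h r ^+ 2.
Proof.
move=> ar; rewrite expr2; under eq_cvg do rewrite expr2.
by apply: cvgM; exact: (warp_cvg h_smooth (k := 0%N) ar).
Qed.

Lemma mass_defect_cvg r p : radii a b r -> Q z.1 z.2 @[z --> (r, p)] --> Q r p.
Proof.
move=> ar; pose i := chart_at A p; have ip : chart_dom i p by exact: dom_chart_at.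
apply: (@cvg_trans _ ((fun z : R * N =>
   h z.1 ^+ 2 / 4 * distortion_trace G (log_slope h z.1) i z.1 z.2) @ (r, p))).
  apply: near_eq_cvg; apply: filterS (near_chart ar ip) => z [zr zi].
  rewrite /Q /mass_defect; congr (_ * _).
  by have [_ ->] := curvature_trace_chart g_metric zr zi (dom_chart_at A z.2).
have hz : h z.1 ^+ 2 @[z --> (r, p)] --> h r ^+ 2.
  by apply: cvg_comp (warp_sqr_cvg ar); exact: cvg_fst.
have [_ tr_cvg] := curvature_trace_cvg g_metric ar ip.
have dz := tr_cvg _ (log_slope_cvg h_gt0 h_smooth ar).
exact: (cvgM (cvgM hz (cvg_cst _)) dz).
Qed.

(** Joint continuity restricts to both families of slices. *)
Lemma slice_pair (r : R) (p : N) :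
  ((s, p) @[s --> r] --> (r, p)) /\ ((r, q) @[q --> p] --> (r, p)).
Proof.
split.
- by apply: (@cvg_pair _ _ _ _ (nbhs r) (nbhs p)); [exact: cvg_id|exact: cvg_cst].
- by apply: (@cvg_pair _ _ _ _ (nbhs r) (nbhs p)); [exact: cvg_cst|exact: cvg_id].
Qed.

Lemma radial_mass_cvg r p : radii a b r -> m r q @[q --> p] --> m r p.
Proof.
move=> ar; pose i := chart_at A p; have ip : chart_dom i p by exact: dom_chart_at.
pose f q := h r ^+ 2 * (d%:R * log_slope h r - 2^-1 * curvature_trace G i r q).
have -> : m r p = f p by exact: (radial_massE h_gt0 h_smooth Ghat_metric _ _ ar).
apply: (@cvg_trans _ (f @ p)).
  apply: near_eq_cvg; apply: filterS (nbhs_chart_dom ip) => q iq.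
  rewrite /m (radial_massE h_gt0 h_smooth Ghat_metric _ _ ar).
  by have [<- _] := curvature_trace_chart g_metric ar iq (dom_chart_at A q).
apply: cvgM; first exact: cvg_cst.
apply: cvgB; first exact: cvg_cst.
apply: cvgM; first exact: cvg_cst.
have [ct _] := curvature_trace_cvg g_metric ar ip.
exact: (cvg_comp _ _ (slice_pair r p).2 ct).
Qed.

Lemma ricci_excess_cvg r p : radii a b r -> E s p @[s --> r] --> E r p.
Proof.
move=> ar; pose i := chart_at A p; have ip : chart_dom i p by exact: dom_chart_at.
pose X s := invmx (G s i p) *m radial_jet G i 1 s p.
pose f s := h s ^+ 2 * (- (2^-1 * \tr (invmx (G s i p) *m radial_jet G i 2 s p))
     + 4^-1 * \tr (X s *m X s) + d%:R * (derive1n 2 h s / h s)).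
have fE s : radii a b s -> E s p = f s.
  by move=> as_; exact: (ricci_excessE h_gt0 h_smooth Ghat_metric g_metric _ as_).
rewrite fE//; apply: (@cvg_trans _ (f @ r)).
  by apply: near_eq_cvg; apply: filterS (radii_near ar) => s as_; rewrite fE.
have jet k : radial_jet G i k s p @[s --> r] --> radial_jet G i k r p.
  exact: (cvg_comp _ _ (slice_pair r p).1 (radial_jet_cvg g_metric (k := k) ar ip)).
have Gi : invmx (G s i p) @[s --> r] --> invmx (G r i p).
  apply: cvg_invmx.
  - exact/posdef_unit/(posdef_family g_metric).
  - apply: filterS (radii_near ar) => s as_.
    exact/posdef_unit/(posdef_family g_metric).
  - by have := jet 0%N; under eq_cvg do rewrite radial_jet0; rewrite radial_jet0.
have XX : X s @[s --> r] --> X r by exact: cvg_mulmx.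
have t1 := cvg_mxtrace (cvg_mulmx Gi (jet 2%N)).
have t2 := cvg_mxtrace (cvg_mulmx XX XX).
have t3 := cvgM (warp_cvg h_smooth (k := 2%N) ar)
  (cvgV (lt0r_neq0 (h_gt0 ar)) (warp_cvg h_smooth (k := 0%N) ar)).
apply: cvgM (warp_sqr_cvg ar) _; apply: cvgD; last by apply: cvgM; [exact: cvg_cst|exact: t3].
apply: cvgD; last by apply: cvgM; [exact: cvg_cst|exact: t2].
by apply: cvgN; apply: cvgM; [exact: cvg_cst|exact: t1].
Qed.

Lemma radial_mass_integrable r : radii a b r -> mu.-integrable setT (EFin \o m r).
Proof.
move=> ar; have mc p := radial_mass_cvg (p := p) ar.
apply: measurable_bounded_integrable => //.
- exact: riemannian_measure_finite mu_Ghat N_compact.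
- exact: cvg_measurable_funT.
have : compact (m r @` [set: N]).
  by apply: continuous_compact => //; apply: continuous_subspaceT.
move=> /compact_bounded [M [Mr MB]]; exists M; split => // x Mx p _.
by apply: MB Mx _ _; exists p.
Qed.

Let box al be : set (R * borel_type N) := `[al, be]%classic `*` setT.

(** The integral of the mass defect over a compact piece of the cylinder is the
    gap in the inequality for that piece. *)
Lemma mass_balance al be : radii a b al -> radii a b be -> al < be ->
  (lebesgue_measure \x mu)%E.-integrable (radii a b `*` setT)
    (fun z => (E z.1 z.2)%:E) ->
  (\int[(lebesgue_measure \x mu)%E]_(z in box al be) (Q z.1 z.2)%:E =
   (relative_mass mu h Ghat G be - relative_mass mu h Ghat G al
    - \int[(lebesgue_measure \x mu)%E]_(z in box al be) E z.1 z.2)%:E)%E.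
Proof.
move=> a_al be_b al_be E_int.
have in_radii r : al <= r <= be -> radii a b r.
  by move=> /andP[? ?]; exact: radii_between a_al be_b _ _.
have sub : box al be `<=` radii a b `*` setT.
  by move=> z [/= zI _]; split=> //; apply: in_radii; move: zI; rewrite in_itv.
have mbox : measurable (box al be) by apply: measurableX => //; exact: measurable_itv.
have mrad : measurable (radii a b `*` [set: borel_type N]).
  by apply: measurableX => //; apply: open_measurable; exact: radii_open.
apply: integral_evolution => //.
- by move=> r p /in_radii ar; exact: radial_mass_derive.
- move=> r p /in_radii ar; exact: (cvg_comp _ _ (slice_pair r p).1 (mass_defect_cvg ar)).
- by move=> r p /in_radii ar; exact: ricci_excess_cvg.
- by move=> r /in_radii; exact: radial_mass_integrable.
- by move=> r p /in_radii; exact: mass_defect_ge0.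
- apply: measurable_funS mrad sub _; apply: cvg_measurable_fun => //.
    exact: radii_open.
  by move=> r p ar; exact: mass_defect_cvg.
- by move: E_int; apply: integrableS.
Qed.

End MassInequality.

(** * Passage to the limit, and scaling of metrics *)

(** Dominated convergence for the restrictions of f to F k. *)
Lemma cvg_Rintegral_exhaustion d (T : measurableType d) (R : realType)
    (mu : {measure set T -> \bar R}) (D : set T) (F : nat -> set T) (f : T -> R) :
  measurable D -> (forall k, measurable (F k)) -> (forall k, F k `<=` D) ->
  (forall x, D x -> \forall k \near \oo, F k x) ->
  mu.-integrable D (EFin \o f) ->
  \int[mu]_(x in F k) f x @[k --> \oo] --> \int[mu]_(x in D) f x.
Proof.
move=> mD mF FD DF f_int.
have mf : measurable_fun D (EFin \o f) by exact: measurable_int f_int.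
pose f_ k := (EFin \o f) \_ (F k).
have FDE k : D `&` F k = F k by rewrite setIidr.
have mf_ k : measurable_fun D (f_ k).
  by apply/measurable_restrict => //; rewrite FDE; exact: measurable_funS mf.
have f_f : \forall x \ae mu, D x -> f_ k x @[k --> \oo] --> (EFin \o f) x.
  apply: aeW => x Dx; apply: (@cvg_trans _ (cst ((EFin \o f) x) @ \oo)); last exact: cvg_cst.
  by apply: near_eq_cvg; apply: filterS (DF x Dx) => k Fkx; rewrite /f_ patchE mem_set.
have f_le : \forall x \ae mu, forall k, D x -> (`|f_ k x| <= (abse \o (EFin \o f)) x)%E.
  apply: aeW => x k Dx; rewrite /f_ patchE; case: ifPn => _ //=.
  by rewrite normr0 lee_fin.
have [_ _ dom] := dominated_convergence mD mf_ mf f_f (integrable_abse f_int) f_le.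
apply: fine_cvg; rewrite fineK; last exact: integrable_fin_num.
apply: cvg_trans dom; apply: near_eq_cvg; apply: nearW => k.
by rewrite /= -integral_mkcondr FDE.
Qed.

Lemma derive0_radii_cst (R : realType) (a b : \bar R) (f : R -> R) :
  (forall r, radii a b r -> is_derive r 1 f 0) ->
  forall r s, radii a b r -> radii a b s -> f r = f s.
Proof.
move=> df; suff le_cst r s : r <= s -> radii a b r -> radii a b s -> f r = f s.
  move=> r s ar as_; have [rs|sr] := leP r s; first exact: le_cst.
  by apply/esym; apply: le_cst => //; exact: ltW.
move=> rs ar as_; have in_rad x : r <= x <= s -> radii a b x.
  by move=> /andP[? ?]; exact: radii_between ar as_ _ _.
have [||x _ /eqP] := @MVT_segment R f (cst 0) r s rs.
- by move=> x /subset_itv_oo_cc; rewrite in_itv => /in_rad; exact: df.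
- apply/subspace_continuousP => x /=; rewrite in_itv => /in_rad /df[dx _].
  by apply: cvg_within_filter; move/derivable1_diffP/differentiable_continuous : dx.
by rewrite mul0r subr_eq0 => /eqP.
Qed.

Section SmoothScaling.
Context {R : realType} {m : nat}.

Lemma iter_partial_scale (U : set 'rV[R]_m) (F : 'rV[R]_m -> R) (k : R) s y :
  open U -> smooth_on U F -> U y ->
  iter_partial s (k \*: F) y = k * iter_partial s F y.
Proof.
move=> Uo Fs; elim: s y => [//|c s IHs] y Uy /=.
have [_ /(_ c) dF] := Fs s y Uy.
apply: etrans (deriveZ k dF); apply: near_eq_derive.
have : \forall z \near y, U z by apply: open_nbhs_nbhs.
by apply: filterS => z; exact: IHs.
Qed.

Lemma smooth_on_scale (U : set 'rV[R]_m) (F : 'rV[R]_m -> R) (k : R) :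
  open U -> smooth_on U F -> smooth_on U (k \*: F).
Proof.
move=> Uo Fs s y Uy; have [Fc Fd] := Fs s y Uy.
have Un : \forall z \near y, (k \*: iter_partial s F) z = iter_partial s (k \*: F) z.
  have : \forall z \near y, U z by apply: open_nbhs_nbhs.
  by apply: filterS => z Uz; rewrite (iter_partial_scale _ _ Uo Fs Uz).
split.
  suff : iter_partial s (k \*: F) z @[z --> y] --> iter_partial s (k \*: F) y by [].
  rewrite (iter_partial_scale _ _ Uo Fs Uy).
  have kF : (k \*: iter_partial s F) z @[z --> y] --> k * iter_partial s F y.
    exact: (cvgM (cvg_cst k) Fc).
  exact: (cvg_trans (near_eq_cvg Un) kF).
by move=> c; apply: near_eq_derivable Un _; exact: derivableZ.
Qed.

Lemma smooth_within_scale (X : set 'rV[R]_m) (F : 'rV[R]_m -> R) (k : R) :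
  smooth_within X F -> smooth_within X (fun y => k * F y).
Proof.
move=> Fs y Xy; have [U [F' [Uo Uy F's FE]]] := Fs y Xy.
exists U, (k \*: F'); split => //; first exact: smooth_on_scale.
by move=> z Uz Xz; rewrite FE.
Qed.

End SmoothScaling.

Lemma riemannian_metric_scale (R : realType) d (N : topologicalType)
    (A : smooth_atlas R d N) (T : tensor_field A) (k : R) : 0 < k ->
  riemannian_metric T -> riemannian_metric (fun i p => k *: T i p).
Proof.
move=> k0 T_riem; split.
- by move=> i p ip; rewrite linearZ /= (Defs.metric_sym T_riem ip).
- move=> i p v ip v0; rewrite -scalemxAr -scalemxAl mxE mulr_gt0//.
  exact: metric_pos T_riem _ _ _ ip v0.
- move=> i c e.
  have -> : (fun y => (k *: T i (psi i y)) c e) = (fun y => k * T i (psi i y) c e).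
    by apply/funext => y; rewrite mxE.
  apply: smooth_within_scale; exact: metric_smooth.
- move=> i j p ip jp; rewrite (metric_transform T_riem ip jp).
  by rewrite -scalemxAr -scalemxAl.
Qed.

(** * The inequality and the equality case *)

Lemma ge_integral_rectangle d1 d2 (T1 : measurableType d1) (T2 : measurableType d2)
    (R : realType) (m1 : {measure set T1 -> \bar R})
    (m2 : {sigma_finite_measure set T2 -> \bar R})
    (J : set T1) (V : set T2) (D : set (T1 * T2)) (f : T1 * T2 -> \bar R) (c : R) :
  measurable J -> measurable V -> measurable D -> J `*` V `<=` D ->
  measurable_fun D f -> (forall z, D z -> 0 <= f z)%E ->
  0 <= c -> (forall z, (J `*` V) z -> c%:E <= f z)%E ->
  (c%:E * (m1 J * m2 V) <= \int[(m1 \x m2)%E]_(z in D) f z)%E.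
Proof.
move=> mJ mV mD JVD mf f0 c0 cf.
have mJV : measurable (J `*` V) by exact: measurableX.
apply: (@le_trans _ _ (\int[(m1 \x m2)%E]_(z in J `*` V) f z)%E); last first.
  exact: ge0_subset_integral.
rewrite -product_measure1E// -integral_cst//; apply: ge0_le_integral => //.
exact: measurable_funS mf.
Qed.

Section EqualityCase.
Context {R : realType} {d : nat} {N : ptopologicalType}.
Variables (A : smooth_atlas R d N) (a b : \bar R).
Hypothesis N_countable : @second_countable N.
Hypothesis N_compact : compact [set: N].
Hypothesis ab : (a < b)%E.
Variables (h : R -> R).
Hypothesis h_gt0 : forall r, radii a b r -> 0 < h r.
Hypothesis h_smooth : forall k r, radii a b r -> derivable (derive1n k h) r 1.
Variables (Ghat : tensor_field A) (Ghat_metric : riemannian_metric Ghat).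
Variable mu : {sigma_finite_measure set (borel_type N) -> \bar R}.
Hypothesis mu_Ghat : riemannian_measure Ghat mu.
Variables (G : R -> tensor_field A) (g_metric : cyl_riemannian a b G).

Let Q := mass_defect h G.

Let Q_ge0 r p : radii a b r -> 0 <= Q r p.
Proof. by move=> ar; exact: (mass_defect_ge0 _ g_metric _ ar). Qed.

(** If the defect vanishes, G' = 2 (h'/h) G in every chart, so that G / h^2 has
    derivative 0. *)
Lemma mass_defect_eq0 : (forall r p, radii a b r -> Q r p = 0) <->
  exists Gtilde : tensor_field A, riemannian_metric Gtilde /\
    same_family a b G (warped h Gtilde).
Proof.
split=> [Q0|[Gt [Gt_metric GE]] r p ar].
  have [c0 ac0] := radii_nonempty ab.
  have jetE i r p : radii a b r -> chart_dom i p ->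
      radial_jet G i 1 r p = (2 * log_slope h r) *: G r i p.
    move=> ar ip.
    have [_ +] := distortion_trace_ge0 g_metric (log_slope h r) ar ip; apply.
    have [_ ->] := curvature_trace_chart g_metric ar ip (dom_chart_at A p).
    have /eqP := Q0 r p ar; rewrite /Q /mass_defect mulf_eq0 => /orP[|/eqP//].
    by rewrite mulf_eq0 invr_eq0 pnatr_eq0 orbF expf_eq0 /= gt_eqF// h_gt0.
  have h0 r : radii a b r -> h r != 0 by move=> ar; rewrite gt_eqF// h_gt0.
  exists (fun i p => (h c0 ^+ 2)^-1 *: G c0 i p); split.
    apply: riemannian_metric_scale; last exact: g_metric.1.
    by rewrite invr_gt0 exprn_gt0// h_gt0.
  move=> r ar i p ip; rewrite /warped.
  suff -> : (h c0 ^+ 2)^-1 *: G c0 i p = (h r ^+ 2)^-1 *: G r i p.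
    by rewrite scalerA divff ?scale1r// expf_neq0// h0.
  apply/matrixP => c e; rewrite !mxE.
  pose f s := (h s ^+ 2)^-1 * G s i p c e.
  apply: (@derive0_radii_cst _ a b f) => // s as_.
  have dG : is_derive s 1 (fun t => G t i p c e) (2 * log_slope h s * G s i p c e).
    have /is_derive_mxP/(_ c e) := family_derive g_metric as_ ip.
    by rewrite jetE// mxE.
  have hs0 := h0 s as_.
  pose hsqr t := h t ^+ 2; have hsqr0 : hsqr s != 0 by rewrite expf_neq0.
  have dh := is_deriveV hsqr0 (warp_sqr_derive h_smooth as_).
  have := is_deriveM dh dG; move=> df; apply: (is_derive_eq df).
  rewrite /log_slope /hsqr /GRing.scale /=; field.
  by rewrite hs0.
have h0 : h r != 0 by rewrite gt_eqF// h_gt0.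
pose i := chart_at A p; have ip : chart_dom i p by exact: dom_chart_at.
rewrite /Q /mass_defect -/i /distortion_trace.
suff -> : distortion G (log_slope h r) i r p = 0 by rewrite !mulmx0 mxtrace0 mulr0.
apply/eqP; rewrite subr_eq0; apply/eqP.
apply: (is_derive_unique (family_derive g_metric ar ip)).
have dG := is_derive_scalemx (Gt i p) (warp_sqr_derive h_smooth ar).
rewrite (GE r ar i p ip) /warped scalerA.
have -> : 2 * log_slope h r * h r ^+ 2 = 2 * (h r * derive1 h r).
  by rewrite /log_slope; field.
apply: near_eq_is_derive dG; apply: filterS (radii_near ar) => s as_.
by rewrite (GE s as_ i p ip).
Qed.

Variables (Ma Mb : R).
Hypothesis Ma_lim : relative_mass mu h Ghat G r @[r --> nbhs_in a b a] --> Ma.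
Hypothesis Mb_lim : relative_mass mu h Ghat G r @[r --> nbhs_in a b b] --> Mb.
Hypothesis excess_L1 : (lebesgue_measure \x mu)%E.-integrable
       (radii a b `*` setT)
       (fun z => (ricci_excess a b h Ghat G z.1 z.2)%:E).

Let I := \int[(lebesgue_measure \x mu)%E]_(z in radii a b `*` setT)
             ricci_excess a b h Ghat G z.1 z.2.
Let box al be : set (R * borel_type N) := `[al, be]%classic `*` setT.

(** The inequality and its equality case are both read off from q, which is
    nonnegative and tends to the gap Mb - Ma - I. *)
Lemma defect_exhaustion : exists (al be q : nat -> R),
  [/\ forall k, [/\ radii a b (al k), radii a b (be k) & al k < be k],
      forall r, radii a b r -> \forall k \near \oo, al k <= r <= be k,
      forall k, (\int[(lebesgue_measure \x mu)%E]_(z in box (al k) (be k))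
         (Q z.1 z.2)%:E = (q k)%:E)%E &
      q k @[k --> \oo] --> Mb - Ma - I].
Proof.
have [al [be [ab_in al_a be_b exh]]] := radii_exhaustion ab.
pose q k := relative_mass mu h Ghat G (be k) - relative_mass mu h Ghat G (al k)
  - \int[(lebesgue_measure \x mu)%E]_(z in box (al k) (be k))
      ricci_excess a b h Ghat G z.1 z.2.
exists al, be, q; split => //.
  move=> k; have [ak bk abk] := ab_in k.
  exact: (mass_balance N_countable N_compact h_gt0 h_smooth Ghat_metric mu_Ghat
    g_metric ak bk abk excess_L1).
apply: cvgB; first apply: cvgB.
- exact: cvg_trans (cvg_app _ be_b) Mb_lim.
- exact: cvg_trans (cvg_app _ al_a) Ma_lim.
apply: cvg_Rintegral_exhaustion => //.
- by apply: measurableX => //; apply: open_measurable; exact: radii_open.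
- by move=> k; apply: measurableX => //; exact: measurable_itv.
- move=> k z [/= zI _]; split=> //; have [ak bk _] := ab_in k.
  by move: zI; rewrite in_itv => /andP[? ?]; exact: radii_between ak bk _ _.
- by move=> z [/= zr _]; apply: filterS (exh _ zr) => k zk; split.
Qed.

Lemma mass_inequality : I <= Mb - Ma.
Proof.
have [al [be [q [ab_in _ qE q_lim]]]] := defect_exhaustion.
rewrite -subr_ge0 -(cvg_lim _ q_lim)//; apply: limr_ge.
  by apply/cvg_ex; exists (Mb - Ma - I).
apply: nearW => k; rewrite -lee_fin -qE; apply: integral_ge0 => z [/= zI _].
have [ak bk _] := ab_in k; rewrite lee_fin; apply: Q_ge0.
by move: zI; rewrite in_itv => /andP[? ?]; exact: radii_between ak bk _ _.
Qed.

(** A positive value of the defect persists on a rectangle J x V, V open, which all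
    but finitely many of the pieces contain; then q k is bounded below by a
    positive multiple of the measure of V and cannot tend to 0. *)
Lemma mass_equality : Mb - Ma = I <-> (forall r p, radii a b r -> Q r p = 0).
Proof.
have [al [be [q [ab_in exh qE q_lim]]]] := defect_exhaustion.
have in_rad k z : box (al k) (be k) z -> radii a b z.1.
  move=> [/= zI _]; have [ak bk _] := ab_in k.
  by move: zI; rewrite in_itv => /andP[? ?]; exact: radii_between ak bk _ _.
split=> [MI|Q0]; last first.
  have q0 k : q k = 0.
    have : (q k)%:E = 0%E.
      by rewrite -qE; apply: integral0_eq => z /in_rad zr; rewrite Q0.
    by case.
  apply/eqP; rewrite -subr_eq0 -(cvg_lim _ q_lim)//.
  by rewrite (_ : q = cst 0) ?lim_cst//; apply/funext.
move=> r p ar; apply/eqP; rewrite eq_le; apply/andP; split; last exact: Q_ge0.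
rewrite leNgt; apply/negP => Q_gt0.
pose c := Q r p / 2; have c0 : 0 < c by rewrite divr_gt0.
have [[X V] [/= rX pV] XVQ] : \forall z \near (r, p), radii a b z.1 /\ c < Q z.1 z.2.
  have n1 : \forall w \near (r, p), radii a b w.1 by apply: cvg_fst (radii_near ar).
  have n2 : \forall w \near (r, p), c < Q w.1 w.2.
    apply: (cvgr_gt _ (mass_defect_cvg h_gt0 h_smooth g_metric (p := p) ar)).
    by rewrite ltr_pdivrMr// ltr_pMr// ltr1n.
  by apply: filterS2 n1 n2.
have [e e0 eX] : exists2 e, 0 < e & `[r - e, r + e]%classic `<=` X.
  move/nbhs_ballP : rX => [e /= e0 eX]; exists (e / 2); first by rewrite divr_gt0.
  move=> s /=; rewrite in_itv /= => /andP[? ?]; apply: eX; rewrite /ball /=.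
  by rewrite ltr_norml; apply/andP; split; lra.
have V'S : V° `<=` V by exact: interior_subset.
have V'o : open V° by exact: open_interior.
pose J := `[r - e, r + e]%classic.
have J_rad s : J s -> radii a b s.
  by move=> Js; have [] := XVQ (s, p) (conj (eX _ Js) (nbhs_singleton pV)).
have mJ : measurable J by exact: measurable_itv.
have mV : measurable (V° : set (borel_type N)) by exact: open_borel.
have mJV : measurable (J `*` V° : set (R * borel_type N)) by exact: measurableX.
have mbox k : measurable (box (al k) (be k)).
  by apply: measurableX => //; exact: measurable_itv.
have Q_meas (D : set (R * borel_type N)) : measurable D -> D `<=` radii a b `*` setT ->
    measurable_fun D (fun z => (Q z.1 z.2)%:E).
  move=> mD Dr; apply/measurable_EFinP.
  have mrad : measurable (radii a b `*` [set: borel_type N]).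
    by apply: measurableX => //; apply: open_measurable; exact: radii_open.
  apply: measurable_funS mrad Dr _; apply: cvg_measurable_fun => //.
    exact: radii_open.
  by move=> s o as_; exact: (mass_defect_cvg h_gt0 h_smooth g_metric as_).
pose eta := (c%:E * ((2 * e)%:E * mu V°))%E.
have mu_fin : mu V° \is a fin_num.
  rewrite ge0_fin_numE//.
  apply: le_lt_trans (riemannian_measure_finite Ghat_metric mu_Ghat N_compact).
  by apply: le_measure; rewrite ?inE//; exact: open_borel.
have eta_gt0 : (0 < eta)%E.
  have V_gt0 : (0 < mu V°)%E.
    by apply: (riemannian_measure_open_gt0 Ghat_metric mu_Ghat V'o); exists p; exact: pV.
  have e2 : 0 < 2 * e by rewrite mulr_gt0.
  by apply: mule_gt0; rewrite ?lte_fin//; apply: mule_gt0; rewrite ?lte_fin.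
have eta_le k : al k <= r - e -> r + e <= be k -> (eta <= (q k)%:E)%E.
  move=> ak bk; rewrite -qE.
  have muJ : lebesgue_measure J = (2 * e)%:E :> \bar R.
    rewrite lebesgue_measure_itv /= lte_fin (_ : r - e < r + e); last lra.
    by rewrite -EFinD; congr (_%:E); ring.
  rewrite /eta -muJ; apply: (ge_integral_rectangle lebesgue_measure mu mJ mV
    (mbox k) _ (Q_meas _ (mbox k) _) _ (ltW c0)).
  - move=> z [/= zJ _]; move: zJ; rewrite /J /= in_itv /= => /andP[z1 z2].
    by split; rewrite //= in_itv /= (le_trans ak)// (le_trans z2).
  - by move=> z /in_rad.
  - by move=> z /in_rad zr; rewrite lee_fin; exact: Q_ge0.
  - move=> z [zJ zV]; rewrite lee_fin ltW//.
    by have [] := XVQ z (conj (eX _ zJ) (V'S _ zV)).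
have q0 : q k @[k --> \oo] --> 0 by move: q_lim; rewrite MI subrr.
have etaE : eta = (fine eta)%:E by rewrite fineK// /eta !fin_numM.
have fine_gt0 : 0 < fine eta by rewrite -lte_fin -etaE.
have n1 : \forall k \near \oo, q k < fine eta by exact: (cvgr_lt _ q0).
have Jl : J (r - e) by rewrite /J /= in_itv /=; apply/andP; split; lra.
have Jr : J (r + e) by rewrite /J /= in_itv /=; apply/andP; split; lra.
have n2 := exh _ (J_rad _ Jl); have n3 := exh _ (J_rad _ Jr).
have [k [qk [/andP[ak _] /andP[_ bk]]]] := filter_ex (filterI n1 (filterI n2 n3)).
by move: qk; rewrite /= ltNge -lee_fin -etaE eta_le.
Qed.

(** Since G = h^2 Gt, the norm of G - h^2 Ghat with respect to h^2 Ghat is that of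
    Gt - Ghat with respect to Ghat, for all r; a constant that becomes smaller
    than any positive number is 0. *)
Lemma asymptotic_unique (Gt : tensor_field A) (r0 : \bar R) :
  riemannian_metric Gt -> same_family a b G (warped h Gt) ->
  (a <= r0 <= b)%E -> asymptotic_at a b G (warped h Ghat) r0 ->
  same_tensor Gt Ghat.
Proof.
move=> Gt_metric GE r0_in asym.
suff GtE p : Gt (chart_at A p) p = Ghat (chart_at A p) p.
  move=> i p ip; have cp := dom_chart_at A p.
  by rewrite (metric_transform Gt_metric ip cp) (metric_transform Ghat_metric ip cp) GtE.
set i := chart_at A p; have ip : chart_dom i p by exact: dom_chart_at.
pose S := Gt i p - Ghat i p.
have Ghat_pos := posdef_metric Ghat_metric ip.
have S_sym : S^T = S.
  by rewrite linearB /= (Defs.metric_sym Gt_metric ip) (Defs.metric_sym Ghat_metric ip).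
have [tr_ge0 tr0] := posdef_tr_sqr Ghat_pos S_sym.
apply/eqP; rewrite -subr_eq0; apply/eqP; apply: tr0.
set t := \tr _ in tr_ge0 *.
have norm_t r : radii a b r ->
    tensor_norm (warped h Ghat r i p) (G r i p - warped h Ghat r i p) = Num.sqrt t.
  move=> ar; have h0 : h r ^+ 2 \is a GRing.unit by rewrite unitfE expf_neq0// gt_eqF// h_gt0.
  rewrite /tensor_norm (GE r ar i p ip) /warped -scalerBr -/S.
  have -> : (h r ^+ 2 *: S)^T = h r ^+ 2 *: S by rewrite linearZ /= S_sym.
  rewrite invmxZ ?unitmxZ ?posdef_unit//.
  rewrite -!scalemxAl -!scalemxAr -?scalemxAl !scalerA.
  by rewrite divrr// mul1r mulVr// scale1r /t !mulmxA.
apply/eqP; rewrite eq_le tr_ge0 andbT leNgt; apply/negP => t_gt0.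
have [|r ar] := nbhs_in_ex ab r0_in (asym (Num.sqrt t) _).
  by rewrite sqrtr_gt0.
by move=> /(_ p) /=; rewrite norm_t// ltxx.
Qed.

End EqualityCase.

Theorem theorem1p1 (R : realType) (n : nat) (hn : (2 <= n)%N)
    (N : ptopologicalType) (A : smooth_atlas R n.-1 N)
    (N_hausdorff : hausdorff_space N) (N_countable : @second_countable N)
    (N_compact : compact [set: N])
    (a b : \bar R) (ab : (a < b)%E)
    (h : R -> R) (h_gt0 : forall r, radii a b r -> 0 < h r)
    (h_smooth : forall k r, radii a b r -> derivable (derive1n k h) r 1)
    (Ghat : tensor_field A) (Ghat_metric : riemannian_metric Ghat)
    (mu : {sigma_finite_measure set (borel_type N) -> \bar R})
    (mu_Ghat : riemannian_measure Ghat mu)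
    (G : R -> tensor_field A) (g_metric : cyl_riemannian a b G)
    (Ma Mb : R)
    (Ma_lim : relative_mass mu h Ghat G r @[r --> nbhs_in a b a] --> Ma)
    (Mb_lim : relative_mass mu h Ghat G r @[r --> nbhs_in a b b] --> Mb)
    (excess_L1 : (lebesgue_measure \x mu)%E.-integrable
       (radii a b `*` setT)
       (fun z => (ricci_excess a b h Ghat G z.1 z.2)%:E)) :
  let I := \int[(lebesgue_measure \x mu)%E]_(z in radii a b `*` setT)
             ricci_excess a b h Ghat G z.1 z.2 in
  [/\ I <= Mb - Ma,
      Mb - Ma = I <->
        (exists Gtilde : tensor_field A, riemannian_metric Gtilde /\
           same_family a b G (warped h Gtilde)) &
      forall r0 : \bar R, (a <= r0 <= b)%E ->
        asymptotic_at a b G (warped h Ghat) r0 ->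
        (Mb - Ma = I <-> same_family a b G (warped h Ghat))].
Proof.
move=> I.
have eqI : Mb - Ma = I <-> exists Gtilde : tensor_field A,
    riemannian_metric Gtilde /\ same_family a b G (warped h Gtilde).
  apply: (iff_trans (mass_equality N_countable N_compact ab h_gt0 h_smooth
    Ghat_metric mu_Ghat g_metric Ma_lim Mb_lim excess_L1)).
  exact: mass_defect_eq0.
split => //.
  exact: (mass_inequality N_countable N_compact ab h_gt0 h_smooth
    Ghat_metric mu_Ghat g_metric Ma_lim Mb_lim excess_L1).
move=> r0 r0_in asym; apply: (iff_trans eqI); split=> [[Gt [Gt_metric GE]]|GE].
  have GtE := asymptotic_unique ab h_gt0 Ghat_metric Gt_metric GE r0_in asym.
  by move=> r ar i p ip; rewrite (GE r ar i p ip) /warped GtE.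
by exists Ghat.
Qed.
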